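(* Let $m\ge3$. For every non-overlapping pattern $\sigma\in\mathcal S_m$ there exists $n_0$ such that $$\alpha_n(12\dots(m-2)\,m\,(m-1))\le\alpha_n(\sigma)\le\alpha_n(1\,3\,4\dots m\,2)\quad\text{for all } n\ge n_0.$$
   Context: $\mathcal S_n$ is the set of permutations of $\{1,\dots,n\}$ written in one-line notation. For a sequence $\tau=\tau_1\dots\tau_k$ of distinct positive integers, $\operatorname{st}(\tau)\in\mathcal S_k$ is obtained by replacing the smallest entry of $\tau$ by $1$, the second smallest by $2$, and so on. For $\sigma\in\mathcal S_m$ and $\pi\in\mathcal S_n$, an occurrence of $\sigma$ in $\pi$ as a consecutive pattern is a block of adjacent entries with $\operatorname{st}(\pi_i\pi_{i+1}\cdots\pi_{i+m-1})=\sigma$. The permutation $\pi$ avoids $\sigma$ if it has no such occurrence, and $\alpha_n(\sigma)$ is the number of permutations in $\mathcal S_n$ that avoid $\sigma$ as a consecutive pattern. The overlap set of $\sigma\in\mathcal S_m$ is $O_\sigma=\{i: 1\le i<m,\ \operatorname{st}(\sigma_{i+1}\sigma_{i+2}\dots\sigma_m)=\operatorname{st}(\sigma_1\sigma_2\dots\sigma_{m-i})\}$. For $m\ge 3$, $\sigma\in\mathcal S_m$ is non-overlapping if $O_\sigma=\{m-1\}$. Here $12\dots(m-2)\,m\,(m-1)$ is the identity permutation with its last two entries swapped (for $m=3$ it is $132$), and $1\,3\,4\dots m\,2$ is the permutation whose one-line notation is $1$, then $3,4,\dots,m$, then $2$. *)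

(* Defs.v *)
From mathcomp Require Import all_boot all_fingroup.

Set Implicit Arguments.
Unset Strict Implicit.
Unset Printing Implicit Defensive.

(* One-line notation: ['S_n] permutes {0, ..., n-1}, hence the shift by one. *)
Definition word (n : nat) (p : 'S_n) : seq nat := [seq (p i).+1 | i <- enum 'I_n].

(* Standardization, for words without repeated letters: each letter is
   replaced by its rank. *)
Definition st (s : seq nat) : seq nat :=
  [seq (count (fun y => y < x) s).+1 | x <- s].

(* Positions are counted from 0: the block of [w] starting at [i] is
   w_{i+1} ... w_{i+m}, where m = size s. *)
Definition occurs_at (s w : seq nat) (i : nat) : bool :=
  (i + size s <= size w) && (st (take (size s) (drop i w)) == s).

Definition avoids (s w : seq nat) : bool :=
  ~~ [exists i : 'I_(size w).+1, occurs_at s w i].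

(* Patterns are given by their one-line notation. *)
Definition alpha (n : nat) (s : seq nat) : nat :=
  #|[set p : 'S_n | avoids s (word p)]|.

Definition overlap_set (s : seq nat) : pred nat :=
  [pred i | (1 <= i < size s) &&
            (st (drop i s) == st (take (size s - i) s))].

Definition non_overlapping (s : seq nat) : Prop :=
  overlap_set s =i pred1 (size s).-1.

(* 1 2 ... (m-2) m (m-1) *)
Definition swap_last (m : nat) : seq nat := iota 1 (m - 2) ++ [:: m; m.-1].

(* 1 3 4 ... m 2 *)
Definition two_last (m : nat) : seq nat := 1 :: iota 3 (m - 2) ++ [:: 2].

Lemma word_surj (n : nat) (s : seq nat) :
  perm_eq s (iota 1 n) -> exists p : 'S_n, word p = s.
Proof.
move=> ps; have sz : size s = n by rewrite (perm_size ps) size_iota.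
have us : uniq s by rewrite (perm_uniq ps) iota_uniq.
have bnd (i : 'I_n) : (0 < nth 0 s i) && ((nth 0 s i).-1 < n).
  have : nth 0 s i \in s by rewrite mem_nth // sz.
  by rewrite (perm_mem ps) mem_iota add1n ltnS; case: (nth 0 s i).
pose f (i : 'I_n) := Ordinal (proj2 (andP (bnd i))).
have f_inj : injective f.
  move=> i j /(congr1 val) /= eq_ij; apply/val_inj/eqP.
  rewrite -(nth_uniq 0 _ _ us) ?sz ?ltn_ord //; apply/eqP.
  case/andP: (bnd i) => + _; case/andP: (bnd j) => + _.
  by move: eq_ij; case: (nth 0 s i) (nth 0 s j) => [|a] [|b] //= ->.
exists (perm f_inj); apply: (@eq_from_nth _ 0) => [|k].
  by rewrite size_map size_enum_ord sz.
rewrite size_map size_enum_ord => lt_kn.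
rewrite (nth_map (Ordinal lt_kn)) ?size_enum_ord // permE /= nth_enum_ord //.
by case/andP: (bnd (Ordinal lt_kn)) => /= /prednK.
Qed.

Lemma swap_last_word (m : nat) : 3 <= m -> exists p : 'S_m, word p = swap_last m.
Proof.
case: m => [|[|m]] // _; apply: word_surj.
have -> : iota 1 m.+2 = iota 1 m ++ [:: m.+1; m.+2].
  by rewrite -[X in iota _ X]addn2 iotaD add1n.
by rewrite /swap_last subn2 perm_cat2l (perm_catC [:: _] [:: _]).
Qed.

Lemma two_last_word (m : nat) : 3 <= m -> exists p : 'S_m, word p = two_last m.
Proof.
case: m => [|[|m]] // _; apply: word_surj.
by rewrite /two_last subn2 /= perm_cons (perm_catC _ [:: 2]).
Qed.

(* Main.v *)
Require Import Defs.
From mathcomp Require Import all_boot all_fingroup all_order all_algebra.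
From mathcomp Require Import zify ring lra.

(** Put [M = m - 1] and [A_n = alpha_n / n!]. Occurrences of a non-overlapping
    pattern share at most one letter, so inclusion-exclusion gives
    [A_{n+1} = sum_k (-1)^k c_k A_{n-kM}], where [c_k] is the probability that a
    random permutation of [kM+1] letters is a [k]-cluster: [k] occurrences, each
    sharing one letter with the next. Here [c_0 = 1] and [c_1 = 1/m!] do not
    depend on the pattern and [c_{k+1} <= c_k / M!], while the recurrence forces
    [A_{n+1} >= (9/10) A_n] when [M >= 3]. Hence, when two patterns are compared,
    the terms with [k >= 3] are dominated by any sizeable gap between the two
    values of [c_2], and such a gap orders the two sequences for every [n].

    Permuting the inner letters of all blocks shows that [c_k] depends only on the
    first letter [a] and the last letter [b] (counted from 0), and only up to
    reversal and complement. Moreover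
    [(2M+1)! c_2 = C(a+b, b) C(2M-a-b, M-b)], which is extremal, by a sizeable
    margin, exactly at [{a, b} = {0, 1}] and [{0, M-1}] up to symmetry, once the
    pairs that no non-overlapping pattern realizes are excluded. *)

Set Implicit Arguments.
Unset Strict Implicit.
Unset Printing Implicit Defensive.

Import GRing.Theory Num.Theory Order.TTheory.

(** * Alternating recurrences *)

Section AlternatingRecurrence.
Local Open Scope ring_scope.
Variable R : realFieldType.

(* A solution [x] of the recurrence satisfies [x_n <= (10/9) x_{n+1}], so consecutive
   terms of the recurrence decrease at least by the factor [decay M]. *)
Definition decay (M : nat) : R := (10 / 9) ^+ M / (M`!)%:R.

Lemma decay_ge0 M : 0 <= decay M.
Proof. by rewrite divr_ge0 ?exprn_ge0 ?ler0n //; lra. Qed.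

Lemma decayS M : decay M.+1 = decay M * (10 / 9 / M.+1%:R).
Proof.
by rewrite /decay exprSr factS natrM invfM (mulrC (_^-1)) mulrACA.
Qed.

Lemma decayS_le M : (0 < M)%N -> decay M.+1 <= decay M.
Proof.
move=> M0; rewrite decayS ler_piMr ?decay_ge0 // ler_pdivrMr ?ltr0n //.
have : (2 <= M.+1%:R :> R) by rewrite ler_nat.
lra.
Qed.

Lemma decay_homo N M : (0 < N)%N -> (N <= M)%N -> decay M <= decay N.
Proof.
move=> N0; elim: M => [|M IH]; first by case: N N0.
rewrite leq_eqVlt => /orP[/eqP-> //|]; rewrite ltnS => NM.
by apply: le_trans (IH NM); apply: decayS_le; apply: leq_trans NM.
Qed.

Lemma decay_le4 M : (3 <= M)%N -> decay M <= 1 / 4.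
Proof.
move=> h; apply: le_trans (decay_homo _ h) _ => //.
rewrite /decay !factS fact0; lra.
Qed.

Lemma decay_le15 M : (4 <= M)%N -> decay M <= 1 / 15.
Proof.
move=> h; apply: le_trans (decay_homo _ h) _ => //.
rewrite /decay !factS fact0; lra.
Qed.

(** The induction proves the sharper bound [r * (y 0 - y K)], which telescopes. *)
Lemma geometric_tail (y : nat -> R) (r : R) K :
  (forall k, 0 <= y k) -> (forall k, y k.+1 <= r * y k) -> r < 1 -> 0 <= r ->
  (1 - r) * \sum_(k < K) y k.+1 <= r * y 0%N.
Proof.
move=> y0 yS r1 r0.
suff: (1 - r) * \sum_(k < K) y k.+1 <= r * (y 0%N - y K).
  by move/le_trans; apply; rewrite ler_wpM2l // lerBlDr lerDl.
elim: K => [|K IH]; first by rewrite big_ord0 mulr0 subrr mulr0.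
rewrite big_ord_recr /= mulrDr; move: IH (yS K); lra.
Qed.

(** The delayed value $x_{n-kM}$. Without the test, truncated subtraction would give [x 0] instead
    of zero once [k * M] exceeds [n]. *)
Definition lag (M : nat) (x : nat -> R) (n k : nat) : R :=
  if (k * M <= n)%N then x (n - k * M)%N else 0.

Lemma lag0 M x n : lag M x n 0 = x n.
Proof. by rewrite /lag mul0n subn0. Qed.

Lemma lag_ge0 M x n k : (forall j, (j <= n)%N -> 0 <= x j) -> 0 <= lag M x n k.
Proof. by move=> x0; rewrite /lag; case: ifP => // _; apply/x0/leq_subr. Qed.

(** Going back [M] indices costs a factor 10/9 each; once the delay runs below index 0 the left side
    is zero. *)
Lemma lag_step M x n k :
  (forall j, (j <= n)%N -> 0 <= x j) ->
  (forall j, (j < n)%N -> 9 / 10 * x j <= x j.+1) ->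
  lag M x n k.+1 <= (10 / 9) ^+ M * lag M x n k.
Proof.
move=> x0 xS; rewrite {1}/lag; case: ifP => h; last first.
  by rewrite mulr_ge0 ?lag_ge0 ?exprn_ge0 //; lra.
rewrite /lag (leq_trans _ h) ?leq_mul2r ?leqnSn ?orbT //.
have -> : (n - k * M = n - k.+1 * M + M)%N by lia.
have: (n - k.+1 * M + M <= n)%N by lia.
elim: M {h} (n - k.+1 * M)%N => [|N IH] a; first by rewrite expr0 mul1r addn0.
rewrite addnS => hN; apply: le_trans (IH a (ltnW hN)) _.
rewrite exprSr -mulrA ler_wpM2l ?exprn_ge0 //; first by lra.
move: (xS _ hN); lra.
Qed.

(** All that the analysis uses about cluster probabilities; the first two values are common to all
    patterns of one length. *)
Definition cluster_weights (M : nat) (c : nat -> R) :=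
  [/\ c 0%N = 1, c 1%N = 1 / (M.+1`!)%:R, forall k, 0 <= c k
    & forall k, c k.+1 <= c k / (M`!)%:R].

Lemma lag_weight_step M c x n k :
  (forall k, 0 <= c k) -> (forall k, c k.+1 <= c k / (M`!)%:R) ->
  (forall j, (j <= n)%N -> 0 <= x j) ->
  (forall j, (j < n)%N -> 9 / 10 * x j <= x j.+1) ->
  c k.+1 * lag M x n k.+1 <= decay M * (c k * lag M x n k).
Proof.
move=> c0 cS x0 xS.
have -> : decay M * (c k * lag M x n k) =
    (c k / (M`!)%:R) * ((10 / 9) ^+ M * lag M x n k) by rewrite /decay; ring.
by apply: ler_pM; rewrite ?lag_ge0 ?lag_step.
Qed.

Lemma alt_sum_ge (y : nat -> R) n : (forall k, 0 <= y k) ->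
  y 0%N - \sum_(k < n) y k.+1 <= \sum_(k < n.+1) (-1) ^+ k * y k.
Proof.
move=> y0; rewrite big_ord_recl /= expr0 mul1r lerD2l -sumrN ler_sum // => k _.
rewrite /bump /= add1n -signr_odd; case: odd; rewrite ?expr1 ?expr0 ?mulN1r //.
by rewrite mul1r; apply: le_trans (y0 _); rewrite oppr_le0.
Qed.

(** The [k = 1] term is at most [x n / 16] and later terms decrease with ratio at most 1/4, so the
    terms with [k >= 1] remove at most $\frac1{16}\cdot\frac43=\frac1{12}<\frac1{10}$ of [x n]. The
    forcing term [g] lets the lemma apply to differences of solutions. *)
Lemma recurrence_growth M c (x g : nat -> R) : (3 <= M)%N -> cluster_weights M c ->
  0 <= x 0%N -> (forall n, 0 <= g n) ->
  (forall n, x n.+1 = \sum_(k < n.+1) (-1) ^+ k * (c k * lag M x n k) + g n) ->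
  forall n, 0 <= x n /\ 9 / 10 * x n <= x n.+1.
Proof.
move=> M3 [c0 c1 cge cS] x0 g0 rec.
suff IH n : (forall j, (j <= n)%N -> 0 <= x j) /\
    (forall j, (j < n)%N -> 9 / 10 * x j <= x j.+1).
  by move=> n; have [+ _] := IH n; have [_ +] := IH n.+1 => h1 h2; split; auto.
elim: n => [|n [pos gr]]; first by split=> // j; rewrite leqn0 => /eqP->.
suff xn : 9 / 10 * x n <= x n.+1.
  have xn0 : 0 <= x n by apply: pos.
  split=> j; rewrite leq_eqVlt ?ltnS => /orP[/eqP|]; auto.
    by move=> ->; lra.
  by move=> [->].
pose y k := c k * lag M x n k.
have y0 k : 0 <= y k by rewrite mulr_ge0 ?lag_ge0.
have yS k : y k.+1 <= decay M * y k by apply: lag_weight_step.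
have d4 := decay_le4 M3; have d0 := decay_ge0 M.
have tail := @geometric_tail (fun k => y k.+1) (decay M) n
  (fun k => y0 _) (fun k => yS _) ltac:(lra) d0.
have y0E : y 0%N = x n by rewrite /y lag0 c0 mul1r.
(* The value of [c 1] saves a further factor [M + 1 >= 4] over [decay M <= 1/4]. *)
have y1 : y 1%N <= 1 / 16 * x n.
  have xn0 : 0 <= x n by apply: pos.
  have : y 1%N <= decay M / M.+1%:R * x n.
    have -> : decay M / M.+1%:R * x n = c 1%N * ((10 / 9) ^+ M * lag M x n 0).
      rewrite c1 lag0 /decay factS natrM invfM. ring.
    by rewrite ler_wpM2l ?lag_step.
  move/le_trans; apply; rewrite ler_wpM2r // ler_pdivrMr ?ltr0n //.
  have : (4 <= M.+1%:R :> R) by rewrite ler_nat.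
  lra.
have alt := alt_sum_ge n y0.
have split_sum : \sum_(k < n) y k.+1 <= y 1%N + \sum_(k < n) y k.+2.
  case: (n) => [|n']; first by rewrite !big_ord0 addr0.
  rewrite big_ord_recl lerD2l big_ord_recr /= lerDl; exact: y0.
have S0 : 0 <= \sum_(k < n) y k.+2 by rewrite sumr_ge0.
have rn := rec n; have gn := g0 n; rewrite -/(y _) in rn.
rewrite rn; rewrite y0E in alt.
have S1 : (3 / 4) * (\sum_(k < n) y k.+2) <= 1 / 4 * y 1%N.
  have : (1 - decay M - 3 / 4) * \sum_(k < n) y k.+2 >= 0.
    by rewrite mulr_ge0 //; lra.
  have : (1 / 4 - decay M) * y 1%N >= 0 by rewrite mulr_ge0 //; lra.
  move: tail; lra.
have := pos n (leqnn n); rewrite /y in alt *; lra.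
Qed.

(** The difference [x - z] solves the recurrence of [d] with forcing term [g], so [g >= 0] suffices
    by [recurrence_growth]. In [g] the terms [k = 0, 1] cancel, and the relative gap [nu] at [k = 2]
    outweighs the geometric tail from [k = 3] on. *)
Lemma recurrence_le M (c d x z : nat -> R) nu : (3 <= M)%N ->
  cluster_weights M c -> cluster_weights M d ->
  x 0%N = 1 -> z 0%N = 1 ->
  (forall n, x n.+1 = \sum_(k < n.+1) (-1) ^+ k * (c k * lag M x n k)) ->
  (forall n, z n.+1 = \sum_(k < n.+1) (-1) ^+ k * (d k * lag M z n k)) ->
  decay M <= nu * (1 - decay M) -> 0 <= nu -> d 2 <= (1 - nu) * c 2 ->
  forall n, z n <= x n.
Proof.
move=> M3 wc wd x0 z0 recx recz hnu nu0 gap.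
have [c0 c1 cge cS] := wc; have [d0 d1 dge dS] := wd.
have gx n : 0 <= x n /\ 9 / 10 * x n <= x n.+1.
  apply: (@recurrence_growth M c x (fun=> 0)); rewrite ?x0 // => k.
  by rewrite addr0.
pose g n := \sum_(k < n.+1) (-1) ^+ k * ((c k - d k) * lag M x n k).
have lagB n k : lag M (fun j => x j - z j) n k = lag M x n k - lag M z n k.
  by rewrite /lag; case: ifP; rewrite ?subrr.
suff g0 n : 0 <= g n.
  move=> n; rewrite -subr_ge0.
  have rz0 : 0 <= x 0%N - z 0%N by rewrite x0 z0 subrr.
  have rec k : x k.+1 - z k.+1 = \sum_(i < k.+1)
      (-1) ^+ i * (d i * lag M (fun j => x j - z j) k i) + g k.
    rewrite recx recz /g -sumrB -big_split /=; apply: eq_bigr => i _.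
    by rewrite lagB; ring.
  by have [] := @recurrence_growth M d (fun j => x j - z j) g M3 wd rz0 g0 rec n.
have lag_pos k : 0 <= lag M x n k.
  by apply: lag_ge0 => j _; apply: (proj1 (gx j)).
rewrite /g; case: n lag_pos => [|[|n]] lag_pos.
- by rewrite big_ord1 c0 d0 subrr mul0r mulr0.
- by rewrite big_ord_recl big_ord1 /= c0 d0 c1 d1 !subrr !mul0r !mulr0 addr0.
rewrite 2!big_ord_recl /= c0 d0 c1 d1 !subrr !mul0r !mulr0 !add0r.
(* The maximum dominates [|c k - d k|], inherits the ratio bound, and equals [c 2] at [k = 2]. *)
pose e k := Num.max (c k) (d k).
have e_ge k : 0 <= e k by rewrite le_max cge.
have eS k : e k.+1 <= e k / (M`!)%:R.
  have h : 0 <= ((M`!)%:R)^-1 :> R by rewrite invr_ge0 ler0n.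
  rewrite ge_max; apply/andP; split.
    by apply: le_trans (cS k) _; rewrite ler_wpM2r // le_max lexx.
  by apply: le_trans (dS k) _; rewrite ler_wpM2r // le_max lexx orbT.
pose y k := e k * lag M x n.+2 k.
have y0 k : 0 <= y k by rewrite mulr_ge0.
have yS k : y k.+1 <= decay M * y k.
  by apply: lag_weight_step => // j _; [apply: (proj1 (gx j))|apply: (proj2 (gx j))].
have d4 := decay_le4 M3; have d0' := decay_ge0 M.
rewrite big_ord_recl /= /bump /= !add1n expr2 mulrNN !mul1r.
have tail := @geometric_tail (fun k => y k.+2) (decay M) n
  (fun k => y0 _) (fun k => yS _) ltac:(lra) d0'.
have bnd : - \sum_(k < n) y k.+3 <=
    \sum_(i < n) (-1) ^+ i.+3 * ((c i.+3 - d i.+3) * lag M x n.+2 i.+3).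
  rewrite -sumrN ler_sum // => i _; rewrite /y.
  have : c i.+3 <= e i.+3 by rewrite /e le_max lexx.
  have : d i.+3 <= e i.+3 by rewrite /e le_max lexx orbT.
  move: (cge i.+3) (dge i.+3) (lag_pos i.+3); set l := lag _ _ _ _.
  move: (c _) (d _) (e _) => p r t p0 r0 l0 rt pt.
  rewrite -signr_odd -mulNr; case: odd; rewrite ?expr1 ?expr0 ?mulN1r ?mul1r.
    by rewrite -mulNr ler_wpM2r //; lra.
  by rewrite ler_wpM2r //; lra.
have y2 : y 2 = c 2 * lag M x n.+2 2.
  rewrite /y /e; congr (_ * _); apply: max_l.
  apply: le_trans gap _; rewrite ler_piMl //; lra.
have S0 : 0 <= \sum_(k < n) y k.+3 by rewrite sumr_ge0.
have l2 := lag_pos 2.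
have h1 : \sum_(k < n) y k.+3 <= nu * y 2.
  have p : 0 < 1 - decay M by lra.
  rewrite -(ler_pM2l p) (le_trans tail) //.
  have : 0 <= (nu * (1 - decay M) - decay M) * y 2 by rewrite mulr_ge0 ?subr_ge0.
  move: (y 2) => t; lra.
have h2 : nu * y 2 <= (c 2 - d 2) * lag M x n.+2 2.
  by rewrite y2 mulrA ler_wpM2r //; lra.
under eq_bigr do rewrite !add1n.
by rewrite addrC -lerBlDr sub0r; lra.
Qed.

Lemma recurrence_eq M (c d x z : nat -> R) : (forall k, c k = d k) -> x 0%N = z 0%N ->
  (forall n, x n.+1 = \sum_(k < n.+1) (-1) ^+ k * (c k * lag M x n k)) ->
  (forall n, z n.+1 = \sum_(k < n.+1) (-1) ^+ k * (d k * lag M z n k)) ->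
  x =1 z.
Proof.
move=> cd xz0 recx recz n.
elim/ltn_ind: n => -[|n] IH //; rewrite recx recz; apply: eq_bigr => k _.
rewrite cd /lag; case: ifP => // _; rewrite IH // ltnS; exact: leq_subr.
Qed.

End AlternatingRecurrence.

(** * Order types of disjoint blocks of positions *)

Section OrderType.

Definition rk (k : nat) (f : 'I_k -> nat) (i : 'I_k) : nat :=
  #|[set j | f j < f i]|.

Lemma ltn_rk k (f : 'I_k -> nat) i j : (rk f i < rk f j) = (f i < f j).
Proof.
case: (ltnP (f i) (f j)) => [lt_ij|le_ji]; last first.
  apply/negbTE; rewrite -leqNgt; apply/subset_leq_card/subsetP => x.
  by rewrite !inE => /leq_trans; apply.
apply: proper_card; apply/properP; split.
  by apply/subsetP => x; rewrite !inE => /ltn_trans; apply.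
by exists i; rewrite !inE ?ltnn.
Qed.

Lemma rk_lt k (f : 'I_k -> nat) i : rk f i < k.
Proof.
have sub : [set j | f j < f i] \proper [set: 'I_k].
  by apply/properP; split; [apply: subsetT|exists i; rewrite ?inE ?ltnn].
by have := proper_card sub; rewrite cardsT card_ord.
Qed.

Lemma eq_rk k (f g : 'I_k -> nat) :
  (forall i j, (f i < f j) = (g i < g j)) -> rk f =1 rk g.
Proof. by move=> fg i; apply: eq_card => j; rewrite !inE fg. Qed.

Lemma card_ord_lt n v : v <= n -> #|[set i : 'I_n | i < v]| = v.
Proof.
move=> le_vn; have winj : injective (widen_ord le_vn).
  by move=> i j /(congr1 val) /= /val_inj.
rewrite -[RHS]card_ord -(card_imset _ winj).
apply: eq_card => i; rewrite inE; apply/idP/imsetP => [iv|[j _ ->]].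
  by exists (Ordinal iv) => //; apply: val_inj.
exact: (ltn_ord j).
Qed.

Lemma rk_perm k (u : 'S_k) i : rk (fun j => u j) i = u i.
Proof.
rewrite -[RHS](@card_ord_lt k) ?(ltnW (ltn_ord _)) //.
rewrite -(card_preimset _ (@perm_inj _ u)); apply: eq_card => j.
by rewrite !inE.
Qed.

Lemma perm_eq_order k (u v : 'S_k) :
  (forall i j, (u i < u j) = (v i < v j)) -> u = v.
Proof.
by move=> uv; apply/permP => i; apply: val_inj; rewrite /= -!rk_perm; apply: eq_rk.
Qed.

Variables (k n : nat) (e : 'I_k -> 'I_n) (inj_e : injective e).

Lemma rk_ord_inj (p : 'S_n) :
  injective (fun i => Ordinal (rk_lt (fun j => p (e j)) i)).
Proof.
move=> i j /(congr1 val) /= eq_rk; apply/inj_e/(@perm_inj _ p)/val_inj/eqP.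
have := ltn_rk (fun j => p (e j)) i j; have := ltn_rk (fun j => p (e j)) j i.
by rewrite eq_rk ltnn /=; case: ltngtP.
Qed.

(** The relative order of the entries of [p] at the positions [e]: the counterpart of [st] for
    permutations. *)
Definition pat (p : 'S_n) : 'S_k := perm (@rk_ord_inj p).

Lemma pat_rk p i : pat p i = rk (fun j => p (e j)) i :> nat.
Proof. by rewrite permE. Qed.

Lemma ltn_pat p i j : (pat p i < pat p j) = (p (e i) < p (e j)).
Proof. by rewrite !pat_rk ltn_rk. Qed.

(** Transports [u] along [e] and fixes the other positions, so that [ext u * p] shuffles the entries
    of [p] at the positions [e]. *)
Definition ext_fun (u : 'S_k) (x : 'I_n) : 'I_n :=
  if [pick i | e i == x] is Some i then e (u i) else x.

Lemma ext_funE u i : ext_fun u (e i) = e (u i).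
Proof.
rewrite /ext_fun; case: pickP => [j /eqP/inj_e-> //|].
by move/(_ i); rewrite eqxx.
Qed.

Lemma ext_fun_out u x : (forall i, e i != x) -> ext_fun u x = x.
Proof.
rewrite /ext_fun => h; case: pickP => // i; by rewrite (negbTE (h i)).
Qed.

Lemma ext_funK u : cancel (ext_fun u) (ext_fun u^-1).
Proof.
move=> x; case: (pickP (fun i => e i == x)) => [i /eqP <-|h].
  by rewrite !ext_funE permK.
by rewrite !ext_fun_out // => i; rewrite h.
Qed.

Definition ext (u : 'S_k) : 'S_n := perm (can_inj (ext_funK u)).

Lemma extE u i : ext u (e i) = e (u i).
Proof. by rewrite permE ext_funE. Qed.

Lemma ext_out u x : (forall i, e i != x) -> ext u x = x.
Proof. by rewrite permE; apply: ext_fun_out. Qed.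

Lemma pat_ext u p : pat (ext u * p) = (u * pat p)%g.
Proof.
by apply: perm_eq_order => i j; rewrite !permM !ltn_pat !permM !extE.
Qed.

End OrderType.

Lemma pat_ext_disjoint k l n (e1 : 'I_k -> 'I_n) (e2 : 'I_l -> 'I_n)
    (inj1 : injective e1) (inj2 : injective e2) (u : 'S_k) (p : 'S_n) :
  (forall i j, e1 i != e2 j) -> pat inj2 (ext inj1 u * p) = pat inj2 p.
Proof.
move=> dis; apply: perm_eq_order => i j; rewrite !ltn_pat !permM.
by rewrite !ext_out // => x.
Qed.

(* Permuting the positions inside either block permutes the pairs of order types
   transitively, hence all pairs are equally frequent. *)
Lemma card_pat_indep k l n (e1 : 'I_k -> 'I_n) (e2 : 'I_l -> 'I_n)
    (inj1 : injective e1) (inj2 : injective e2)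
    (P : pred 'S_k) (Q : pred 'S_l) : (forall i j, e1 i != e2 j) ->
  #|[set p : 'S_n | P (pat inj1 p) && Q (pat inj2 p)]| * (k`! * l`!) =
  #|P| * #|Q| * n`!.
Proof.
move=> dis.
have dis' i j : e2 i != e1 j by rewrite eq_sym.
have card_shift T (u : {perm T}) (A : pred {perm T}) : #|[pred x | A (x * u)%g]| = #|A|.
  have -> : #|[pred x | A (x * u)%g]| = #|[pred x in A]|.
    rewrite -(card_image (mulIg u)); apply: eq_card => x.
    apply/imageP/idP => [[y Ay ->] //|Ax].
    by exists (x * u^-1)%g; rewrite ?inE mulgKV.
  by apply: eq_card.
(* Double counting of triples [(u, v, p)]: for fixed [(u, v)] the shift is absorbed by reindexing
   [p], for fixed [p] by reindexing [u] and [v]. *)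
pose X (uv : 'S_k * 'S_l) (p : 'S_n) :=
  P (uv.1 * pat inj1 p)%g && Q (uv.2 * pat inj2 p)%g.
have cardX uv : \sum_p X uv p =
    #|[set p : 'S_n | P (pat inj1 p) && Q (pat inj2 p)]|.
  rewrite -sum1dep_card.
  rewrite [RHS](reindex_inj (mulgI (ext inj1 uv.1 * ext inj2 uv.2)%g)).
  rewrite [RHS]big_mkcond /=; apply: eq_bigr => p _.
  rewrite -mulgA pat_ext pat_ext_disjoint // pat_ext_disjoint // pat_ext /X.
  by case: ifP.
have cardX' p : \sum_uv X uv p = #|P| * #|Q|.
  have -> : \sum_uv X uv p =
      \sum_u \sum_v (P (u * pat inj1 p)%g * Q (v * pat inj2 p)%g).
    by rewrite pair_big /=; apply: eq_bigr => -[u v] _; rewrite -mulnb.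
  under eq_bigr do rewrite -big_distrr /=.
  rewrite -big_distrl /=; congr (_ * _).
    rewrite -(card_shift _ (pat inj1 p) P) -sum1_card [RHS]big_mkcond.
    by apply: eq_bigr => u _; rewrite inE; case: ifP.
  rewrite -(card_shift _ (pat inj2 p) Q) -sum1_card [RHS]big_mkcond.
  by apply: eq_bigr => u _; rewrite inE; case: ifP.
have <- : \sum_uv \sum_p X uv p =
    #|[set p : 'S_n | P (pat inj1 p) && Q (pat inj2 p)]| * (k`! * l`!).
  under eq_bigr do rewrite cardX.
  by rewrite sum_nat_const card_prod !card_Sn mulnC.
rewrite exchange_big; under eq_bigr do rewrite cardX'.
by rewrite sum_nat_const card_Sn mulnC.
Qed.

(** * Occurrences and clusters *)

Lemma ltn_count_lt (u : seq nat) a b : a \in u ->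
  (count (fun y => y < a) u < count (fun y => y < b) u) = (a < b).
Proof.
move=> a_u; case: (ltnP a b) => [lt_ab|le_ba]; last first.
  apply/negbTE; rewrite -leqNgt; apply: sub_count => x /= /leq_trans; exact.
have -> : count (fun y => y < b) u =
    count (fun y => y < a) u + count (fun y => a <= y < b) u.
  rewrite -count_predUI addnC [X in _ = X + _](@eq_count _ _ pred0) ?count_pred0.
    by rewrite add0n; apply: eq_count => x /=; lia.
  by move=> x /=; lia.
by rewrite -[X in X < _]addn0 ltn_add2l -has_count; apply/hasP; exists a; rewrite ?leqnn.
Qed.

Lemma size_st u : size (st u) = size u.
Proof. by rewrite size_map. Qed.

Lemma nth_st u x : x < size u ->
  nth 0 (st u) x = (count (fun y => y < nth 0 u x) u).+1.
Proof. by move=> xu; rewrite (nth_map 0). Qed.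

Lemma st_eqP (u v : seq nat) : size u = size v ->
  reflect (forall x y, x < size u -> y < size u ->
             (nth 0 u x < nth 0 u y) = (nth 0 v x < nth 0 v y))
          (st u == st v).
Proof.
move=> size_uv; apply: (iffP eqP) => [st_uv x y xu yu|order_uv].
  rewrite -[LHS](@ltn_count_lt u) ?mem_nth // -[RHS](@ltn_count_lt v) ?mem_nth -?size_uv //.
  by rewrite -ltnS -!nth_st -?size_uv // st_uv -[RHS]ltnS -!nth_st -?size_uv.
apply: (@eq_from_nth _ 0) => [|x]; rewrite !size_st // => xu.
rewrite !nth_st -?size_uv //; congr _.+1.
have count_iota (w : seq nat) a :
    count (fun y => y < a) w = count (fun i => nth 0 w i < a) (iota 0 (size w)).
  by rewrite -{1}[w](mkseq_nth 0) count_map.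
rewrite !count_iota -size_uv; apply: eq_in_count => i.
by rewrite mem_iota /= => iu; apply: order_uv.
Qed.

Lemma size_word n (p : 'S_n) : size (word p) = n.
Proof. by rewrite size_map size_enum_ord. Qed.

(** Positions are natural numbers, so that blocks can be shifted without casts. Letters count from
    1; past the end the default 0 is read. *)
Definition letter n (p : 'S_n) (i : nat) : nat := nth 0 (word p) i.

Lemma letterE n (p : 'S_n) (i : 'I_n) : letter p i = (p i).+1.
Proof.
by rewrite /letter (nth_map i) ?size_enum_ord // nth_ord_enum.
Qed.

Lemma ltn_letter n (p : 'S_n) x y (xn : x < n) (yn : y < n) :
  (letter p x < letter p y) = (p (Ordinal xn) < p (Ordinal yn)).
Proof. by rewrite (letterE p (Ordinal xn)) (letterE p (Ordinal yn)). Qed.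

Lemma st_word n (p : 'S_n) : st (word p) = word p.
Proof.
apply: (@eq_from_nth _ 0) => [|x]; rewrite ?size_st // => xn.
rewrite nth_st // -!/(letter p _); rewrite size_word in xn.
rewrite (letterE p (Ordinal xn)) count_map -[in RHS]rk_perm; congr _.+1.
rewrite -size_filter enumT /rk cardE; congr size; rewrite /enum_mem.
by apply: eq_filter => i; rewrite /= ltnS; apply: esym; apply: in_set.
Qed.

(** An occurrence expressed by comparisons only; that the block fits into the word is ensured
    separately. *)
Definition occ (m : nat) (g f : nat -> nat) (i : nat) : bool :=
  [forall x : 'I_m, forall y : 'I_m, (f (i + x) < f (i + y)) == (g x < g y)].

Lemma occP m g f i :
  reflect (forall x y, x < m -> y < m -> (f (i + x) < f (i + y)) = (g x < g y))
          (occ m g f i).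
Proof.
apply: (iffP forallP) => [h x y xm ym|h x]; last first.
  by apply/forallP => y; rewrite h.
by have /forallP/(_ (Ordinal ym))/eqP := h (Ordinal xm).
Qed.

Lemma eq_occ m g f f' i i' :
  (forall x y, x < m -> y < m ->
     (f (i + x) < f (i + y)) = (f' (i' + x) < f' (i' + y))) ->
  occ m g f i = occ m g f' i'.
Proof.
by move=> ff'; apply/occP/occP => h x y xm ym; rewrite -h // ff'.
Qed.

Lemma occurs_at_occ m n (s : 'S_m) (p : 'S_n) i :
  occurs_at (word s) (word p) i = (i + m <= n) && occ m (letter s) (letter p) i.
Proof.
rewrite /occurs_at !size_word; case: leqP => //= imn.
have sz : size (take m (drop i (word p))) = m.
  by rewrite size_takel // size_drop size_word; lia.
have nthE x : x < m -> nth 0 (take m (drop i (word p))) x = letter p (i + x).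
  by move=> xm; rewrite nth_take // nth_drop.
rewrite -[X in _ == X]st_word; apply/st_eqP/occP => [|h x y xm ym|h x y].
- by rewrite sz size_word.
- by rewrite -!nthE ?h // sz.
- by rewrite sz => xm ym; rewrite !nthE ?h.
Qed.

Definition noocc (m : nat) (g f : nat -> nat) (l : nat) : bool :=
  [forall i : 'I_l.+1, (i + m <= l) ==> ~~ occ m g f i].

Lemma nooccP m g f l :
  reflect (forall i, i + m <= l -> ~~ occ m g f i) (noocc m g f l).
Proof.
apply: (iffP forallP) => [h i iml|h i]; last by apply/implyP/h.
have il : i < l.+1 by lia.
exact: implyP (h (Ordinal il)) iml.
Qed.

Lemma alphaE m n (s : 'S_m) :
  alpha n (word s) = #|[set p : 'S_n | noocc m (letter s) (letter p) n]|.
Proof.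
apply: eq_card => p; rewrite !inE /avoids; apply/existsPn/nooccP => h.
  move=> i imn; have im : i < (size (word p)).+1 by rewrite size_word; lia.
  by have := h (Ordinal im); rewrite occurs_at_occ imn.
by move=> i; rewrite occurs_at_occ negb_and -implybE; apply/implyP/h.
Qed.

(** The step [m.-1] makes consecutive occurrences share one letter. For [k = 0] the condition is
    empty and the cluster is a single letter. *)
Definition chain (m : nat) (g f : nat -> nat) (l k : nat) : bool :=
  [forall j : 'I_k, occ m g f (l + j * m.-1)].

Lemma chainP m g f l k :
  reflect (forall j, j < k -> occ m g f (l + j * m.-1)) (chain m g f l k).
Proof.
apply: (iffP forallP) => [h j jk|h j]; last exact/h.
exact: (h (Ordinal jk)).
Qed.

Lemma chainS m g f l k :
  chain m g f l k.+1 = occ m g f l && chain m g f (l + m.-1) k.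
Proof.
apply/chainP/andP => [h|[h0 /chainP h] [|j] jk].
- split; first by have := h 0 isT; rewrite mul0n addn0.
  by apply/chainP => j jk; rewrite -addnA -mulSn; apply: h.
- by rewrite mul0n addn0.
- by rewrite mulSn addnA; apply: h.
Qed.

Lemma ltn_letter_pat k n c (e : 'I_k -> 'I_n) (inj_e : injective e) (p : 'S_n) x y :
  (forall j, e j = c + j :> nat) -> x < k -> y < k ->
  (letter (pat inj_e p) x < letter (pat inj_e p) y) = (letter p (c + x) < letter p (c + y)).
Proof.
move=> ec xk yk; rewrite ltn_letter ltn_pat.
by rewrite -(ec (Ordinal xk)) -(ec (Ordinal yk)) !letterE.
Qed.

Lemma occ_pat m g k n c (e : 'I_k -> 'I_n) (inj_e : injective e) (p : 'S_n) i :
  (forall j, e j = c + j :> nat) -> i + m <= k ->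
  occ m g (letter (pat inj_e p)) i = occ m g (letter p) (c + i).
Proof.
move=> ec imk; apply: eq_occ => x y xm ym.
by rewrite (@ltn_letter_pat _ _ c) ?addnA //; lia.
Qed.

Lemma noocc_pat m g k n (e : 'I_k -> 'I_n) (inj_e : injective e) (p : 'S_n) :
  (forall j, e j = j :> nat) ->
  noocc m g (letter (pat inj_e p)) k = noocc m g (letter p) k.
Proof.
by move=> ec; apply/nooccP/nooccP => h i imk; have := h i imk;
  rewrite (@occ_pat _ _ _ _ 0).
Qed.

Lemma chain_pat m g k n c (e : 'I_k -> 'I_n) (inj_e : injective e) (p : 'S_n) j :
  (forall i, e i = c + i :> nat) -> 0 < m -> j * m.-1 < k ->
  chain m g (letter (pat inj_e p)) 0 j = chain m g (letter p) c j.
Proof.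
move=> ec m0 jk; apply/chainP/chainP => h i ij; have := h i ij;
  by rewrite (@occ_pat _ _ _ _ c) //; nia.
Qed.

(** * Cluster decomposition for a non-overlapping pattern *)

Section Clusters.
Variables (M : nat) (s : 'S_M.+1).
Local Notation g := (letter s).
Local Notation m := M.+1.

Definition clusters (n k : nat) : nat := #|[set p : 'S_n | chain m g (letter p) 0 k]|.

Lemma overlap_setP d : 0 < d <= M ->
  reflect (forall x y, d + x < m -> d + y < m ->
             (g (d + x) < g (d + y)) = (g x < g y))
          (d \in overlap_set (word s)).
Proof.
move=> dM; rewrite inE size_word ltnS dM /=.
have sz : size (drop d (word s)) = size (take (m - d) (word s)).
  by rewrite size_drop size_takel size_word // leq_subr.
have size_d : size (drop d (word s)) = m - d by rewrite size_drop size_word.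
have nth_t x : x < m - d -> nth 0 (take (m - d) (word s)) x = g x.
  by move=> xd; rewrite nth_take.
apply: (iffP (st_eqP sz)) => h x y; have := h x y.
  rewrite size_d !nth_drop => + xm ym; rewrite !nth_t; try lia.
  by apply; lia.
by rewrite size_d !nth_drop => + xm ym; rewrite !nth_t //; apply; lia.
Qed.

(** The common part of two occurrences at distance [d] would put [d] into the overlap set, whose
    only element is [M]. *)
Lemma nonoverlap_occ f i d : non_overlapping (word s) -> 0 < d < M ->
  occ m g f i -> occ m g f (i + d) -> False.
Proof.
move=> no /andP[d0 dM] /occP h1 /occP h2.
have : d \in overlap_set (word s).
  apply/overlap_setP => [|x y xm ym]; first by rewrite d0 ltnW.
  by rewrite -h1 // -h2 ?addnA //; lia.
by rewrite no inE size_word /= => /eqP dE; rewrite dE ltnn in dM.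
Qed.

(** Unlike [noocc] on the prefix of length [l], this also forbids occurrences that start before [l]
    and run past it. *)
Definition tail_free (n l : nat) (f : nat -> nat) : bool :=
  [forall i : 'I_l, (i + m <= n) ==> ~~ occ m g f i].

Lemma tail_freeP n l f :
  reflect (forall i, i < l -> i + m <= n -> ~~ occ m g f i) (tail_free n l f).
Proof.
apply: (iffP forallP) => [h i il imn|h i]; last by apply/implyP/h.
exact: implyP (h (Ordinal il)) imn.
Qed.

(** Here an occurrence starting before the cluster may still run past the prefix; in
    [first_clusters] it may not. *)
Definition preclusters (n l k : nat) : nat :=
  #|[set p : 'S_n | noocc m g (letter p) l && chain m g (letter p) l k]|.

Definition first_clusters (n l k : nat) : nat :=
  #|[set p : 'S_n | tail_free n l (letter p) && chain m g (letter p) l k]|.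

(* By non-overlap, the only occurrence that can start before the cluster and not
   end in the prefix is the one ending at the first letter of the cluster, which
   makes the cluster longer. This is what telescopes in [avoid_prob_rec]. *)
Lemma preclusters_split n l k : 0 < M -> non_overlapping (word s) ->
  l + (k * M).+1 = n ->
  preclusters n l k = first_clusters n l k +
                      (if M <= l then first_clusters n (l - M) k.+1 else 0).
Proof.
move=> M0 no ln.
pose late (p : 'S_n) := (M <= l) && occ m g (letter p) (l - M).
have key (p : 'S_n) : chain m g (letter p) l k -> forall i, i < l -> l < i + m ->
    i + m <= n -> occ m g (letter p) i -> i = l - M /\ M <= l.
  move=> ch i il lim imn oi.
  have [El|iM] := eqVneq (i + M) l; first by split; lia.
  (* For [k = 0] a single letter follows the prefix, so an occurrence leaving the prefix ends there,
     that is [i + M = l]. *)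
  case: k ch ln => [|k']; first by lia.
  rewrite chainS => /andP[ol _] _.
  case: (@nonoverlap_occ (letter p) i (l - i) no _ oi); first lia.
  by rewrite subnKC // ltnW.
rewrite /preclusters -(cardsID [set p | late p]) addnC; congr (_ + _).
  apply: eq_card => p; rewrite !inE.
  case ch: (chain _ _ _ _ _); rewrite ?andbF // !andbT.
  apply/andP/tail_freeP => [[nl /nooccP fr] i il imn|fr].
    apply/negP => oi; case: (leqP (i + m) l) => [iml|lim].
      by move: (fr i iml); rewrite oi.
    have [iE Ml] := key p ch i il lim imn oi.
    by move: nl; rewrite /late -iE Ml oi.
  split; last by apply/nooccP => i iml; apply: fr; lia.
  by apply/andP => -[Ml]; apply/negP/fr; lia.
case: ifPn => [Ml|Ml]; last first.
  by apply: eq_card0 => p; rewrite !inE /late (negbTE Ml) andbF.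
apply: eq_card => p; rewrite !inE /late Ml chainS /= subnK //.
case: (chain _ _ _ l k); rewrite ?andbF // !andbT.
case: (occ _ _ _ (l - M)); rewrite ?andbF // !andbT.
apply/nooccP/tail_freeP => [fr i il imn|fr i iml]; first by apply: fr; lia.
by apply: fr; lia.
Qed.

(** The empty cluster sits at the last letter, and [M > 0] makes every occurrence start before
    it. *)
Lemma first_clusters0 n : 0 < M -> first_clusters n.+1 n 0 = alpha n.+1 (word s).
Proof.
move=> M0; rewrite alphaE; apply: eq_card => p; rewrite !inE.
have -> : chain m g (letter p) n 0 by apply/chainP.
rewrite andbT; apply/tail_freeP/nooccP => fr i; last by move=> _; apply: fr.
by move=> imn; apply: fr => //; lia.
Qed.

(** Prefix and cluster occupy disjoint positions, so their order types are independent. *)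
Lemma preclusters_prod n l k : 0 < M -> n = l + (k * M).+1 ->
  preclusters n l k * (l`! * ((k * M).+1)`!) =
  alpha l (word s) * clusters (k * M).+1 k * n`!.
Proof.
move=> M0 ->; set r := (k * M).+1.
have dis (i : 'I_l) (j : 'I_r) : lshift r i != rshift l j.
  by rewrite -val_eqE /= neq_ltn (leq_trans (ltn_ord i)) ?leq_addr.
have := card_pat_indep (@lshift_inj l r) (@rshift_inj l r)
  (fun u => noocc m g (letter u) l) (fun u => chain m g (letter u) 0 k) dis.
rewrite -[X in _ = X * _ * _]cardsE -[X in _ = _ * X * _]cardsE -alphaE => <-.
congr (_ * _); apply: eq_card => p; rewrite !inE noocc_pat //.
by rewrite (@chain_pat _ _ _ _ l).
Qed.

(** Dropping the last occurrence leaves a shorter cluster, and the order type of the remaining [M]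
    letters is forced; by independence the probability drops at least by the factor [M!]. *)
Lemma clusters_le k :
  clusters (k.+1 * M).+1 k.+1 * (((k * M).+1)`! * M`!) <=
  clusters (k * M).+1 k * ((k.+1 * M).+1)`!.
Proof.
have -> : (k.+1 * M).+1 = (k * M).+1 + M by rewrite mulSn addnC.
set l := (k * M).+1.
have dis (i : 'I_l) (j : 'I_M) : lshift M i != rshift l j.
  by rewrite -val_eqE /= neq_ltn (leq_trans (ltn_ord i)) ?leq_addr.
(* The pattern without its first letter, which belongs to the shorter cluster. *)
pose Q : pred 'S_M := fun u => occ M (fun x => g x.+1) (letter u) 0.
have := card_pat_indep (@lshift_inj l M) (@rshift_inj l M)
  (fun u => chain m g (letter u) 0 k) Q dis.
have Q1 : #|Q| <= 1.
  apply/card_le1_eqP => u v /occP hu /occP hv; apply: perm_eq_order => i j.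
  by have := hu i j; have := hv i j; rewrite !letterE !ltnS => -> // ->.
set X := #|[set p | _]| => XE.
apply: leq_trans (_ : X * (l`! * M`!) <= _).
  rewrite leq_mul2r; apply/orP; right; apply/subset_leq_card/subsetP => p.
  rewrite !inE => /chainP ch; apply/andP; split.
    rewrite (@chain_pat _ _ _ _ 0) ?ltnSn //.
    by apply/chainP => j jk; apply: ch; apply: ltnW.
  have /occP h := ch k (ltnSn k); apply/occP => x y xM yM.
  rewrite add0n (@ltn_letter_pat _ _ l) // -h // /l.
  by congr (letter p _ < letter p _); rewrite /=; lia.
by rewrite XE /clusters cardsE leq_mul2r -[X in _ <= X]muln1 leq_mul ?orbT.
Qed.

Lemma clusters0 : clusters 1 0 = 1.
Proof.
rewrite /clusters -[RHS](card_Sn 1) -cardsT; apply: eq_card => p.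
by rewrite !inE; apply/chainP.
Qed.

Lemma clusters1 : clusters M.+1 1 = 1.
Proof.
rewrite /clusters -[RHS](cards1 s); apply: eq_card => p; rewrite !inE.
apply/chainP/eqP => [/(_ 0 isT)/occP h|-> [|j] // _].
  apply: perm_eq_order => i j; have := h i j (ltn_ord i) (ltn_ord j).
  by rewrite mul0n !add0n !letterE !ltnS.
by apply/occP => x y; rewrite !add0n.
Qed.

End Clusters.

(** * The recurrence for pattern avoidance *)

Section Density.
Local Open Scope ring_scope.
Variables (R : realFieldType) (M : nat) (s : 'S_M.+1).

Definition avoid_prob (n : nat) : R := (alpha n (word s))%:R / (n`!)%:R.

Definition cluster_prob (k : nat) : R :=
  (clusters s (k * M).+1 k)%:R / (((k * M).+1)`!)%:R.

Lemma fact_neq0 n : (n`!)%:R != 0 :> R.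
Proof. by rewrite pnatr_eq0 -lt0n fact_gt0. Qed.

Lemma cluster_prob_weights : cluster_weights M cluster_prob.
Proof.
split.
- by rewrite /cluster_prob mul0n clusters0 divr1.
- by rewrite /cluster_prob mul1n clusters1.
- by move=> k; rewrite divr_ge0 ?ler0n.
move=> k; rewrite /cluster_prob ler_pdivrMr ?ltr0n ?fact_gt0 //.
do 2!rewrite mulrAC ler_pdivlMr ?ltr0n ?fact_gt0 //.
rewrite -!natrM ler_nat -mulnA (mulnC M`!).
exact: clusters_le.
Qed.

Lemma avoid_prob0 : avoid_prob 0 = 1.
Proof.
rewrite /avoid_prob alphaE.
have -> : #|[set p : 'S_0 | noocc M.+1 (letter s) (letter p) 0]| = 1%N.
  rewrite -[RHS](card_Sn 0) -cardsT; apply: eq_card => p; rewrite !inE.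
  by apply/nooccP => i; rewrite addnS.
by rewrite divr1.
Qed.

(** By [preclusters_prod] and [preclusters_split] the [k]-th term without its sign is
    [W k + W k.+1], so the alternating sum telescopes to [W 0], the avoidance probability. *)
Lemma avoid_prob_rec n : (0 < M)%N -> non_overlapping (word s) ->
  avoid_prob n.+1 =
  \sum_(k < n.+1) (-1) ^+ k * (cluster_prob k * lag M avoid_prob n k).
Proof.
move=> M0 no.
pose W k : R := if (k * M <= n)%N
  then (first_clusters s n.+1 (n - k * M) k)%:R / (n.+1`!)%:R else 0.
have term k : cluster_prob k * lag M avoid_prob n k = W k + W k.+1.
  rewrite /lag /W; case: (leqP (k * M) n) => kMn; last first.
    by rewrite mulr0 ifN ?addr0 // -ltnNge; lia.
  have nE : (n.+1 = n - k * M + (k * M).+1)%N by lia.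
  have := preclusters_prod s M0 nE; rewrite (preclusters_split M0 no (esym nE)).
  have -> : (n - k * M - M = n - k.+1 * M)%N by lia.
  have -> : (M <= n - k * M)%N = (k.+1 * M <= n)%N by lia.
  rewrite /cluster_prob /avoid_prob.
  move: (fact_neq0 (n - k * M)) (fact_neq0 (k * M).+1) (fact_neq0 n.+1).
  set f1 := (n - k * M)`!; set f2 := ((k * M).+1)`!; set f3 := (n.+1)`!.
  move: f1 f2 f3 => x y z x0 y0 z0 /(congr1 (fun x : nat => x%:R : R)).
  rewrite !(natrM, natrD) => E.
  apply: (mulIf (mulf_neq0 (mulf_neq0 x0 y0) z0)).
  transitivity ((alpha (n - k * M) (word s))%:R * (clusters s (k * M).+1 k)%:R * z%:R : R).
    by field; rewrite x0 y0.
  by rewrite -E; case: ifP => _; field; rewrite z0.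
have W0 : W 0%N = avoid_prob n.+1 by rewrite /W mul0n subn0 first_clusters0.
have Wn : W n.+1 = 0 by rewrite /W ifN // -ltnNge; nia.
suff tel K : \sum_(k < K) (-1) ^+ k * (W k + W k.+1) = W 0%N - (-1) ^+ K * W K.
  by under eq_bigr do rewrite term; rewrite tel Wn mulr0 subr0.
elim: K => [|K IH]; first by rewrite big_ord0 expr0 mul1r subrr.
by rewrite big_ord_recr /= IH exprS; ring.
Qed.

End Density.

(** Take [nu = 1/(N+1)] in [recurrence_le]: the condition on [decay M] becomes [decay M <= 1/(N+2)],
    and the gap in [c 2] becomes the ratio [N/(N+1)] of cluster counts. *)
Lemma alpha_le (R : realFieldType) M (s t : 'S_M.+1) (N : nat) : 3 <= M ->
  non_overlapping (word s) -> non_overlapping (word t) ->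
  (decay R M <= 1 / N.+2%:R)%R ->
  N.+1 * clusters t (2 * M).+1 2 <= N * clusters s (2 * M).+1 2 ->
  forall n, alpha n (word t) <= alpha n (word s).
Proof.
move=> M3 ns nt gap cl n; have M0 : 0 < M by apply: leq_trans M3.
have N1 : (0 < N.+1%:R :> R)%R by rewrite ltr0n.
have le_prob : (avoid_prob R t n <= avoid_prob R s n)%R.
  apply: (@recurrence_le R M (cluster_prob R s) (cluster_prob R t)
            (avoid_prob R s) (avoid_prob R t) (1 / N.+1%:R)%R);
    rewrite ?avoid_prob0 //; try exact: cluster_prob_weights.
  - by move=> k; apply: avoid_prob_rec.
  - by move=> k; apply: avoid_prob_rec.
  - rewrite mulrAC ler_pdivlMr // mul1r; move: gap.
    by rewrite ler_pdivlMr ?ltr0n // -[N.+2]addn1 natrD; lra.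
  - by rewrite divr_ge0 ?ler01 ?ltW.
  have -> : (1 - 1 / N.+1%:R = N%:R / N.+1%:R :> R)%R.
    by rewrite -{1}(divff (lt0r_neq0 N1)) -mulrBl mulrSr addrK.
  rewrite mulrAC ler_pdivlMr // mulrC /cluster_prob.
  by rewrite mulrA [leRHS]mulrA ler_wpM2r ?invr_ge0 ?ler0n // -!natrM ler_nat.
have f0 : (0 < (n`!)%:R^-1 :> R)%R by rewrite invr_gt0 ltr0n fact_gt0.
by move: le_prob; rewrite /avoid_prob ler_pM2r // ler_nat.
Qed.

Lemma alpha_eq M (s t : 'S_M.+1) : 0 < M ->
  non_overlapping (word s) -> non_overlapping (word t) ->
  (forall k, clusters s (k * M).+1 k = clusters t (k * M).+1 k) ->
  forall n, alpha n (word s) = alpha n (word t).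
Proof.
move=> M0 ns nt st n.
have := @recurrence_eq rat M (cluster_prob rat s) (cluster_prob rat t)
  (avoid_prob rat s) (avoid_prob rat t) _ _ _ _ n.
move=> /(_ _ _ _ _)/(mulIf (invr_neq0 (fact_neq0 rat n))) h.
apply/eqP; rewrite -(eqr_nat rat); apply/eqP/h.
- by move=> k; rewrite /cluster_prob st.
- by rewrite !avoid_prob0.
- by move=> k; apply: avoid_prob_rec.
- by move=> k; apply: avoid_prob_rec.
Qed.

(** * Cluster numbers and the end letters *)

Section Symmetry.
Variable M : nat.
Local Notation m := M.+1.

Lemma clusters_map (s t : 'S_m) n k (F : 'S_n -> 'S_n) : injective F ->
  (forall p, chain m (letter s) (letter p) 0 k ->
             chain m (letter t) (letter (F p)) 0 k) ->
  clusters s n k <= clusters t n k.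
Proof.
move=> injF h; rewrite /clusters -(card_imset _ injF); apply: subset_leq_card.
by apply/subsetP => _ /imsetP[p + ->]; rewrite !inE; apply: h.
Qed.

Lemma letterM n (u p : 'S_n) (i : 'I_n) : letter (u * p)%g i = letter p (u i).
Proof. by rewrite !letterE permM. Qed.

(* [g] acts on each block of positions as [phi]; consecutive blocks share an
   endpoint, which [phi] fixes. *)
Lemma clusters_endpoints_le (s t : 'S_m) k : 0 < M ->
  s ord0 = t ord0 -> s ord_max = t ord_max ->
  clusters s (k * M).+1 k <= clusters t (k * M).+1 k.
Proof.
move=> M0 st0 stM; pose phi := (t * s^-1)%g.
have phiE x : s (phi x) = t x by rewrite permM permKV.
have phi0 : phi ord0 = ord0 by apply: (@perm_inj _ s); rewrite phiE.
have phiM : phi ord_max = ord_max by apply: (@perm_inj _ s); rewrite phiE.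
pose f (i : nat) : nat := phi (inord i).
have fE (i : 'I_m) : f i = phi i by rewrite /f inord_val.
have f_lt i : i < M -> f i < M.
  move=> iM; rewrite ltn_neqAle -ltnS ltn_ord andbT; apply/eqP => fiM.
  have : phi (inord i) = ord_max by apply: val_inj.
  by rewrite -phiM => /perm_inj/(congr1 val); rewrite /= inordK; lia.
have f_inj i j : i < M -> j < M -> f i = f j -> i = j.
  move=> iM jM /val_inj/perm_inj/(congr1 val); rewrite /= !inordK //; lia.
pose g i := i %/ M * M + f (i %% M).
(* For [x = M] division places the position in the next block; both readings agree because [phi]
   fixes the endpoints. *)
have gE j x : x <= M -> g (j * M + x) = j * M + f x.
  rewrite leq_eqVlt => /orP[/eqP ->|xM].
    rewrite -mulSnr /g modnMl mulnK // mulSnr -addnA (fE ord0) (fE ord_max).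
    by rewrite phi0 phiM addn0.
  by rewrite /g divnMDl // divn_small // addn0 modnMDl modn_small.
have g_lt (i : 'I_(k * M).+1) : g i < (k * M).+1.
  have : i <= k * M by rewrite -ltnS.
  rewrite leq_eqVlt => /orP[/eqP ->|iM].
    by have := gE k 0 (leq0n _); rewrite (fE ord0) phi0 !addn0 => ->.
  have := f_lt (i %% M) (ltn_pmod _ M0).
  have : i %/ M < k by rewrite ltn_divLR.
  rewrite /g; nia.
have g_inj : injective (fun i => Ordinal (g_lt i)).
  move=> i j /(congr1 val) /= gij; apply: val_inj.
  have dE (l : nat) : g l %/ M = l %/ M.
    by rewrite /g divnMDl // (@divn_small (f _)) ?addn0 //; apply/f_lt/ltn_pmod.
  have dij : i %/ M = j %/ M by rewrite -(dE i) gij dE.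
  rewrite /= (divn_eq i M) (divn_eq j M) dij; congr (_ + _).
  by apply: f_inj; rewrite ?ltn_pmod //; move: gij; rewrite /g dij => /addnI.
apply: (clusters_map (mulgI (perm g_inj))) => p /chainP ch.
apply/chainP => j jk; have := ch j jk; rewrite !add0n /= => /occP h.
have pE x : x < m -> letter (perm g_inj * p)%g (j * M + x) = letter p (j * M + f x).
  move=> xm; have xn : j * M + x < (k * M).+1 by nia.
  by rewrite (letterM _ _ (Ordinal xn)) permE /= gE.
apply/occP => x y xm ym; rewrite !pE // h; try exact: ltn_ord.
rewrite /f !letterE !phiE -!letterE; by rewrite !inordK.
Qed.

Lemma clusters_endpoints (s t : 'S_m) k : 0 < M ->
  s ord0 = t ord0 -> s ord_max = t ord_max ->
  clusters s (k * M).+1 k = clusters t (k * M).+1 k.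
Proof.
by move=> *; apply/eqP; rewrite eqn_leq !clusters_endpoints_le.
Qed.

(** Multiplied on the left it reverses the word, on the right it complements the letters. *)
Definition rev_perm n : 'S_n := perm (@rev_ord_inj n).

Lemma rev_permE n (i : 'I_n) : rev_perm n i = rev_ord i.
Proof. by rewrite permE. Qed.

Lemma rev_permK n : (rev_perm n * rev_perm n = 1)%g.
Proof. by apply/permP => i; rewrite permM !rev_permE rev_ordK perm1. Qed.

Lemma clusters_rev_le (s : 'S_m) k :
  clusters s (k * M).+1 k <= clusters (rev_perm m * s)%g (k * M).+1 k.
Proof.
apply: (clusters_map (mulgI (rev_perm _))) => p /chainP ch; apply/chainP => j jk.
have := ch (k.-1 - j) ltac:(lia); rewrite !add0n /= => /occP h.
have pE x : x < m -> letter (rev_perm _ * p)%g (j * M + x) =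
    letter p ((k.-1 - j) * M + (M - x)).
  move=> xm; have xn : j * M + x < (k * M).+1 by nia.
  rewrite (letterM _ _ (Ordinal xn)) rev_permE /=; congr letter.
  have : (k.-1 - j) * M = k * M - j.+1 * M by rewrite -mulnBl; congr (_ * _); lia.
  have : j.+1 * M <= k * M by rewrite leq_mul2r jk orbT.
  by rewrite mulSn; lia.
apply/occP => x y xm ym; rewrite !pE // h; try lia.
rewrite (letterM _ _ (Ordinal xm)) (letterM _ _ (Ordinal ym)) !rev_permE /=.
by rewrite !subSS.
Qed.

Lemma clusters_rev (s : 'S_m) k :
  clusters (rev_perm m * s)%g (k * M).+1 k = clusters s (k * M).+1 k.
Proof.
apply/eqP; rewrite eqn_leq clusters_rev_le andbT.
by have := clusters_rev_le (rev_perm m * s)%g k; rewrite mulgA rev_permK mul1g.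
Qed.

Lemma ltn_letter_rev n (p : 'S_n) x y : x < n -> y < n ->
  (letter (p * rev_perm n)%g x < letter (p * rev_perm n)%g y) =
  (letter p y < letter p x).
Proof.
move=> xn yn; rewrite !ltn_letter !permM !rev_permE /=.
by have := ltn_ord (p (Ordinal xn)); have := ltn_ord (p (Ordinal yn)); lia.
Qed.

Lemma clusters_compl_le (s : 'S_m) k :
  clusters s (k * M).+1 k <= clusters (s * rev_perm m)%g (k * M).+1 k.
Proof.
apply: (clusters_map (mulIg (rev_perm _))) => p /chainP ch; apply/chainP => j jk.
have := ch j jk; rewrite !add0n /= => /occP h; apply/occP => x y xm ym.
rewrite !ltn_letter_rev ?h //; nia.
Qed.

Lemma clusters_compl (s : 'S_m) k :
  clusters (s * rev_perm m)%g (k * M).+1 k = clusters s (k * M).+1 k.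
Proof.
apply/eqP; rewrite eqn_leq clusters_compl_le andbT.
by have := clusters_compl_le (s * rev_perm m)%g k; rewrite -mulgA rev_permK mulg1.
Qed.

End Symmetry.

(** * Counting 2-clusters *)

Section TwoClusters.

Definition below n (S : {set 'I_n}) (x : 'I_n) : nat := #|[set y in S | y < x]|.

Lemma below_inj n (S : {set 'I_n}) (x y : 'I_n) :
  x \in S -> y \in S -> below S x = below S y -> x = y.
Proof.
move=> xS yS; apply: contra_eq => neq_xy.
wlog xy : x y xS yS neq_xy / x < y => [hw|].
  have [|yx|/val_inj/eqP] := ltngtP x y; [exact: hw| |by rewrite (negbTE neq_xy)].
  by rewrite eq_sym; apply: hw; rewrite // eq_sym.
rewrite neq_ltn; apply/orP; left; apply: proper_card; apply/properP; split.
  by apply/subsetP => z; rewrite !inE => /andP[-> /ltn_trans]; apply.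
by exists x; rewrite !inE xS ?ltnn ?xy.
Qed.

Lemma below_imset k n (f : 'I_k -> 'I_n) (u : 'S_k) i : injective f ->
  (forall i j, (f i < f j) = (u i < u j)) -> below (f @: setT) (f i) = u i.
Proof.
move=> injf fu; rewrite -rk_perm -(eq_rk fu) /rk -(card_imset _ injf).
apply: eq_card => y; rewrite !inE; apply/andP/imsetP => [[/imsetP[j _ ->] ji]|].
  by exists j; rewrite ?inE.
by case=> j; rewrite inE => ji ->; split => //; apply: imset_f.
Qed.

Lemma order_mono_inj k n (f : 'I_k -> 'I_n) (u : 'S_k) :
  (forall i j, (f i < f j) = (u i < u j)) -> injective f.
Proof.
move=> fu i j fij; apply/(@perm_inj _ u)/val_inj.
have := fu i j; have := fu j i; rewrite fij ltnn.
by case: ltngtP.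
Qed.

(** A set of values can be arranged in exactly one way with a given order type: this is existence,
    [order_imset_eq] is uniqueness. *)
Lemma enum_order k n (S : {set 'I_n}) (u : 'S_k) : #|S| = k ->
  exists f : 'I_k -> 'I_n,
    f @: setT = S /\ forall i j, (f i < f j) = (u i < u j).
Proof.
move=> Sk; case: k / Sk u => u.
have inj : injective (@enum_val _ (mem S)) := @enum_val_inj _ _.
pose r := pat inj 1%g.
pose f i := enum_val (r^-1 (u i))%g.
have fu i j : (f i < f j) = (u i < u j).
  by have := ltn_pat inj 1%g (r^-1 (u i))%g (r^-1 (u j))%g; rewrite !perm1 !permKV.
exists f; split=> //; apply/eqP.
rewrite eqEcard card_imset ?cardsT ?card_ord; last exact: order_mono_inj fu.
by rewrite leqnn andbT; apply/subsetP => _ /imsetP[i _ ->]; apply: enum_valP.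
Qed.

Lemma order_imset_eq k n (f h : 'I_k -> 'I_n) (u : 'S_k) :
  (forall i j, (f i < f j) = (u i < u j)) ->
  (forall i j, (h i < h j) = (u i < u j)) ->
  f @: setT = h @: setT -> f =1 h.
Proof.
move=> fu hu fh i; apply: (@below_inj _ (f @: setT)).
- exact: imset_f.
- by rewrite fh imset_f.
- rewrite (below_imset i (order_mono_inj fu) fu) fh.
  by rewrite (below_imset i (order_mono_inj hu) hu).
Qed.

Variables (M : nat) (s : 'S_M.+1).
Local Notation m := M.+1.
Local Notation n := (2 * M).+1.

Definition blk1 (i : 'I_m) : 'I_n := inord i.
Definition blk2 (i : 'I_m) : 'I_n := inord (M + i).

Lemma blk1E i : blk1 i = i :> nat.
Proof. by rewrite inordK //; have := ltn_ord i; lia. Qed.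

Lemma blk2E i : blk2 i = M + i :> nat.
Proof. by rewrite inordK //; have := ltn_ord i; lia. Qed.

Lemma two_clusterP (p : 'S_n) :
  reflect ((forall i j, (p (blk1 i) < p (blk1 j)) = (s i < s j)) /\
           (forall i j, (p (blk2 i) < p (blk2 j)) = (s i < s j)))
          (chain m (letter s) (letter p) 0 2).
Proof.
rewrite !chainS !add0n /=; have -> : chain m (letter s) (letter p) (M + M) 0.
  by apply/chainP.
rewrite andbT; have b1 (i : 'I_m) : letter p (0 + i) = (p (blk1 i)).+1.
  by rewrite -letterE blk1E.
have b2 (i : 'I_m) : letter p (M + i) = (p (blk2 i)).+1 by rewrite -letterE blk2E.
apply: (iffP andP) => [[/occP h1 /occP h2]|[h1 h2]]; split.
- move=> i j; have := h1 i j (ltn_ord i) (ltn_ord j).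
  by rewrite !b1 !letterE !ltnS.
- move=> i j; have := h2 i j (ltn_ord i) (ltn_ord j).
  by rewrite !b2 !letterE !ltnS.
- apply/occP => x y xm ym.
  by rewrite (b1 (Ordinal xm)) (b1 (Ordinal ym)) ltn_letter !ltnS h1.
- apply/occP => x y xm ym.
  by rewrite (b2 (Ordinal xm)) (b2 (Ordinal ym)) ltn_letter !ltnS h2.
Qed.

Lemma card_ord_gt N v : v < N -> #|[set i : 'I_N | v < i]| = N - v.+1.
Proof.
move=> vN; have := cardsC [set i : 'I_N | i < v.+1].
rewrite card_ord_lt // card_ord => NE; apply/eqP.
rewrite -(eqn_add2l v.+1) subnKC // -[X in _ == X]NE eqn_add2l; apply/eqP.
by apply: eq_card => i; rewrite !inE ltnS -ltnNge.
Qed.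

(* A 2-cluster is determined by the values [v = a + b] at its pivot and, among the
   values below and above [v], those taken by the first block. *)
Lemma clusters2 : 0 < M ->
  clusters s n 2 = 'C(s ord0 + s ord_max, s ord_max) *
                   'C(2 * M - (s ord0 + s ord_max), M - s ord_max).
Proof.
move=> M0; set a := nat_of_ord (s ord0); set b := nat_of_ord (s ord_max).
have aM : a <= M by rewrite -ltnS ltn_ord.
have bM : b <= M by rewrite -ltnS ltn_ord.
have vn : a + b < n by lia.
pose v := Ordinal vn.
pose L := [set x : 'I_n | x < v]; pose U := [set x : 'I_n | v < x].
have cL : #|L| = a + b by rewrite card_ord_lt // ltnW.
have cU : #|U| = 2 * M - (a + b) by rewrite card_ord_gt.
pose X := setX [set B : {set 'I_n} | B \subset L & #|B| == b]
               [set C : {set 'I_n} | C \subset U & #|C| == M - b].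
have cX : #|X| = 'C(a + b, b) * 'C(2 * M - (a + b), M - b).
  by rewrite cardsX !cards_draws cL cU.
pose S (p : 'S_n) := [set p (blk1 i) | i in setT].
pose G (p : 'S_n) := (S p :&: L, S p :&: U).
have blk_pivot : blk1 ord_max = blk2 ord0.
  by apply: val_inj; rewrite /= blk1E blk2E addn0.
pose Cl := [set p : 'S_n | chain m (letter s) (letter p) 0 2].
have pos (x : 'I_n) : (exists i, x = blk1 i) \/ exists2 i : 'I_m, x = blk2 i & 0 < i.
  case: (ltnP x m) => [xm|mx]; [left; exists (inord x)|right; exists (inord (x - M))].
  - by apply: val_inj; rewrite /= blk1E inordK.
  - by apply: val_inj; rewrite /= blk2E inordK; have := ltn_ord x; lia.
  - by rewrite inordK; have := ltn_ord x; lia.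
(* The second block takes the pivot and exactly the values missed by the first. *)
have S2E (p : 'S_n) :
    [set p (blk2 i) | i in setT] = p (blk1 ord_max) |: ~: S p.
  apply/setP => y; rewrite !inE; apply/imsetP/orP => [[i _ ->]|].
    case: (posnP i) => [i0|i0]; [left|right].
      by rewrite (_ : i = ord0) ?blk_pivot //; apply: val_inj.
    apply/imsetP => -[j _ /perm_inj/(congr1 val)]; rewrite /= blk1E blk2E.
    by have := ltn_ord j; lia.
  case=> [/eqP ->|yS]; first by exists ord0; rewrite ?blk_pivot.
  have [[i xi]|[i xi _]] := pos (p^-1 y)%g; last by exists i; rewrite // -xi permKV.
  by case/imsetP: yS; exists i; rewrite // -xi permKV.
have SvE (T : {set 'I_n}) : v \in T -> T = v |: ((T :&: L) :|: (T :&: U)).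
  move=> vT; apply/setP => y; rewrite !inE -[y == v]val_eqE -[v < y]/(a + b < y).
  rewrite -[y < v]/(y < a + b); case: ltngtP => [_|_|yv];
    rewrite ?andbT ?andbF ?orbF //.
  by rewrite (_ : y = v) ?vT //; apply: val_inj.
have belowv (T : {set 'I_n}) : below T v = #|T :&: L|.
  by apply: eq_card => y; rewrite !inE.
have mono1 (p : 'S_n) : p \in Cl -> forall i j, (p (blk1 i) < p (blk1 j)) = (s i < s j).
  by rewrite inE => /two_clusterP[].
have mono2 (p : 'S_n) : p \in Cl -> forall i j, (p (blk2 i) < p (blk2 j)) = (s i < s j).
  by rewrite inE => /two_clusterP[].
(* Below the pivot lie [b] values of the first block, where it comes last, and [a] of the second,
   where it comes first. *)
have pivot (p : 'S_n) : p \in Cl -> p (blk1 ord_max) = v.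
  move=> pCl; set c := p _; apply: val_inj => /=.
  have h1 := below_imset ord_max (order_mono_inj (mono1 p pCl)) (mono1 p pCl).
  have h2 := below_imset ord0 (order_mono_inj (mono2 p pCl)) (mono2 p pCl).
  rewrite S2E -blk_pivot -/c -/(S p) in h1 h2.
  rewrite -[LHS](@card_ord_lt n) ?(ltnW (ltn_ord c)) //.
  rewrite -(cardsID (S p)) addnC /a /b -h1 -h2; congr (_ + _); apply: eq_card => y.
    rewrite !inE; case: (eqVneq y c) => [->|_]; by rewrite ?ltnn ?andbF.
  by rewrite !inE andbC.
have vS (p : 'S_n) : p \in Cl -> v \in S p.
  by move=> /pivot <-; apply: imset_f.
(* The two intersections and [v] recover the value set of each block, and the pattern fixes the
   arrangement. *)
have injG : {in Cl &, injective G}.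
  move=> p q pCl qCl [GL GU].
  have Spq : S p = S q by rewrite (SvE _ (vS p pCl)) GL GU -SvE // vS.
  have e1 := order_imset_eq (mono1 p pCl) (mono1 q qCl) Spq.
  have e2 : (fun i => p (blk2 i)) =1 (fun i => q (blk2 i)).
    apply: (order_imset_eq (mono2 p pCl) (mono2 q qCl)).
    by rewrite !S2E Spq !pivot.
  by apply/permP => x; have [[i ->]|[i -> _]] := pos x; [apply: e1|apply: e2].
have imG : G @: Cl = X.
  apply/setP => -[B C]; apply/imsetP/idP => [[p pCl [-> ->]]|].
    have cB : #|S p :&: L| = b.
      rewrite -belowv -(pivot p pCl).
      exact: below_imset (order_mono_inj (mono1 p pCl)) (mono1 p pCl).
    have cS : #|S p| = m.
      by rewrite card_imset ?cardsT ?card_ord //; apply: order_mono_inj (mono1 p pCl).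
    have LU0 : S p :&: L :&: (S p :&: U) = set0.
      by apply/setP => y; rewrite !inE; case: ltngtP; rewrite ?andbF.
    have := congr1 (fun T : {set 'I_n} => #|T|) (SvE _ (vS p pCl)).
    rewrite /= cS cardsU1 !inE !ltnn !andbF cardsU LU0 cards0 subn0 cB add1n => -[cBC].
    by rewrite !subsetIr eqxx /= -(eqn_add2l b) subnKC // -cBC.
  rewrite !inE /= => /andP[/andP[BL /eqP cB] /andP[CU /eqP cC]].
  pose T := v |: (B :|: C).
  have inB y : y \in B -> y < v by move/(subsetP BL); rewrite inE.
  have inC y : y \in C -> v < y by move/(subsetP CU); rewrite inE.
  have TL : T :&: L = B.
    apply/setP => y; rewrite !inE; case: (boolP (y \in B)) => [/inB|] yB.
      by rewrite yB orbT.
    case: (boolP (y \in C)) => [/inC|] yC; first by rewrite ltnNge ltnW ?andbF.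
    by rewrite !orbF; case: eqP => // ->; rewrite ltnn.
  have TU : T :&: U = C.
    apply/setP => y; rewrite !inE; case: (boolP (y \in C)) => [/inC|] yC.
      by rewrite yC !orbT.
    case: (boolP (y \in B)) => [/inB|] yB; first by rewrite ltnNge ltnW ?andbF.
    by rewrite !orbF; case: eqP => // ->; rewrite ltnn.
  have vBC : v \notin B :|: C.
    by rewrite inE; apply/norP; split; apply/negP;
      [move/inB|move/inC]; rewrite ltnn.
  have cT : #|T| = m.
    rewrite cardsU1 vBC cardsU cB cC (_ : B :&: C = set0) ?cards0; first by lia.
    apply/setP => y; rewrite !inE; apply/negbTE/negP => /andP[/inB yv /inC].
    by rewrite ltnNge ltnW.
  pose T2 := v |: ~: T.
  have vT : v \in T by rewrite setU11.
  have cT2 : #|T2| = m.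
    have := cardsC T; rewrite cT card_ord cardsU1 !inE eqxx /=; lia.
  (* Each block is filled with its value set in the order of the pattern; both fillings put [v] at
     the shared position. *)
  have [f1 [f1T f1s]] := enum_order s cT.
  have [f2 [f2T f2s]] := enum_order s cT2.
  have i1 := order_mono_inj f1s; have i2 := order_mono_inj f2s.
  have f1v : f1 ord_max = v.
    apply: (@below_inj _ T); rewrite // -?f1T ?imset_f //.
    by rewrite (below_imset _ i1 f1s) f1T belowv TL cB.
  have f2v : f2 ord0 = v.
    apply: (@below_inj _ T2); rewrite ?setU11 // -?f2T ?imset_f //.
    rewrite (below_imset _ i2 f2s) f2T belowv.
    have : #|T2 :&: L| = #|L :\: B|.
      apply: eq_card => y; rewrite -TL !inE.
      by case: (eqVneq y v) => [->|]; rewrite ?ltnn ?andbF //=; case: (y < v);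
        rewrite ?andbF ?andbT.
    by rewrite cardsD (setIidPr BL) cL cB => ->; rewrite addnK.
  pose g (x : 'I_n) := if x < m then f1 (inord x) else f2 (inord (x - M)).
  have g1 i : g (blk1 i) = f1 i by rewrite /g blk1E ltn_ord inord_val.
  have g2 i : g (blk2 i) = f2 i.
    case: (posnP i) => [i0|i0].
      have -> : i = ord0 by apply: val_inj.
      by rewrite -blk_pivot g1 f1v f2v.
    have Mi : (M + i < m) = false by lia.
    by rewrite /g blk2E Mi addKn inord_val.
  have dis i j : f1 i = f2 j -> 0 < j -> False.
    move=> fij j0; have : f2 j \in T by rewrite -fij -f1T imset_f.
    have : f2 j \in T2 by rewrite -f2T imset_f.
    rewrite in_setU1 in_setC => /orP[/eqP|/negbTE -> //].
    by rewrite -f2v => /i2 j0'; rewrite j0' in j0.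
  have inj_g : injective g.
    move=> x y; have [[i ->]|[i -> i0]] := pos x; have [[j ->]|[j -> j0]] := pos y;
      rewrite ?g1 ?g2.
    - by move/i1 ->.
    - by move/dis => /(_ j0).
    - by move/esym/dis => /(_ i0).
    - by move/i2 ->.
  have pCl : perm inj_g \in Cl.
    by rewrite inE; apply/two_clusterP; split=> i j; rewrite !permE ?g1 ?g2.
  exists (perm inj_g) => //.
  have ST : S (perm inj_g) = T.
    by rewrite /S -f1T; apply: eq_imset => i; rewrite permE g1.
  by rewrite /G ST TL TU.
by rewrite -cX -imG card_in_imset.
Qed.

End TwoClusters.

(** * Binomial estimates *)

Section Binomials.

(** For [a] and [b] at most [M], the number of lattice paths from $(0,0)$ to $(M,M)$ through
    $(a,b)$. *)
Definition two_cluster_count (M a b : nat) : nat :=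
  'C(a + b, b) * 'C(2 * M - (a + b), M - b).

Local Notation f := two_cluster_count.

Lemma two_cluster_countC M a b : a <= M -> b <= M -> f M a b = f M b a.
Proof.
move=> aM bM; rewrite /f (addnC b a) -(@bin_sub (a + b)) ?leq_addl // addnK.
have h : M - a <= 2 * M - (a + b) by lia.
by rewrite -(bin_sub h) (_ : 2 * M - (a + b) - (M - a) = M - b) //; lia.
Qed.

Lemma two_cluster_count_compl M a b : a <= M -> b <= M ->
  f M (M - a) (M - b) = f M a b.
Proof.
move=> aM bM; rewrite /f [LHS]mulnC.
have -> : M - a + (M - b) = 2 * M - (a + b) by lia.
have -> : 2 * M - (2 * M - (a + b)) = a + b by lia.
by rewrite subKn.
Qed.

(** Compares products through the ratios $p'/p=z/x$ and $q'/q=w/y$ without dividing. *)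
Lemma cross_mul_le x y z w p p' q q' : 0 < x * y ->
  x * p' = z * p -> y * q' = w * q -> z * w <= x * y -> p' * q' <= p * q.
Proof.
move=> xy0 ep eq zw; rewrite -(leq_pmul2l xy0) mulnACA ep eq mulnACA.
by rewrite leq_mul2r zw orbT.
Qed.

(** Raising [b] multiplies the count by $\frac{(a+b+1)(M-b)}{(b+1)(2M-a-b)}$, which is at most 1
    when [a <= b]. *)
Lemma two_cluster_count_decr M a b : a <= b < M -> f M a b.+1 <= f M a b.
Proof.
move=> /andP[ab bM]; rewrite /f addnS.
have [p pE] : exists p, 2 * M - (a + b) = p.+1.
  by exists (2 * M - (a + b)).-1; lia.
have [q qE] : exists q, M - b = q.+1 by exists (M - b).-1; lia.
have -> : 2 * M - (a + b).+1 = p by lia.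
have -> : M - b.+1 = q by lia.
rewrite pE qE; apply: (@cross_mul_le b.+1 p.+1 (a + b).+1 q.+1).
- exact: isT.
- exact: esym (mul_bin_diag (a + b).+1 b).
- exact: mul_bin_diag p.+1 q.
nia.
Qed.

(** Half of the central binomial coefficient $\binom{2k+2}{k+1}$. *)
Definition central (k : nat) : nat := 'C((2 * k).+1, k.+1).

Lemma centralS k : k.+2 * central k.+1 = 2 * (2 * k).+3 * central k.
Proof.
rewrite /central (_ : 2 * k.+1 = (2 * k).+2); last by lia.
have := mul_bin_diag (2 * k).+3 k.+1; rewrite /= => <-; rewrite binS.
have -> : 'C((2 * k).+1, k) = 'C((2 * k).+1, k.+1).
  have kk : k.+1 <= (2 * k).+1 by lia.
  by rewrite -(bin_sub kk) (_ : (2 * k).+1 - k.+1 = k) //; lia.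
move: 'C(_, _) => c; lia.
Qed.

(** Log-convexity: the ratio $2(2k+3)/(k+2)$ of consecutive values increases with $k$. *)
Lemma central_mul_le k l : k <= l ->
  central k.+1 * central l <= central k * central l.+1.
Proof.
move=> kl.
apply: (@cross_mul_le k.+2 (2 * (2 * l).+3) (2 * (2 * k).+3) l.+2).
- by rewrite muln_gt0.
- exact: centralS.
- exact: esym (centralS l).
nia.
Qed.

(** The indices are moved apart with fixed sum until the smaller one is 1. *)
Lemma central_mul_le1 k l : 0 < k <= l ->
  central k * central l <= central 1 * central (k + l).-1.
Proof.
elim: k l => // -[|k] IH l /andP[_ kl]; first by rewrite add1n.
apply: leq_trans (central_mul_le _) _; first exact: ltnW.
by rewrite addSnnS; apply: IH; rewrite /= ltnW // ltnW.
Qed.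

Lemma two_cluster_count_near M a : a < M ->
  f M a a.+1 = central a * central (M - a).-1.
Proof.
move=> aM; rewrite /f /central.
have -> : a + a.+1 = (2 * a).+1 by lia.
have [c cE] : exists c, M - a = c.+1 by exists (M - a).-1; lia.
have -> : 2 * M - (2 * a).+1 = (2 * c).+1 by lia.
have -> : M - a.+1 = c by lia.
have h : c <= (2 * c).+1 by lia.
by rewrite cE -(bin_sub h) (_ : (2 * c).+1 - c = c.+1) //; lia.
Qed.

Lemma two_cluster_count_le M a b k : a <= b <= M -> b <= k <= M ->
  f M a k <= f M a b.
Proof.
move=> /andP[ab bM]; elim: k => [|k IH] /andP[bk kM].
  by rewrite (_ : b = 0) //; lia.
case: (ltngtP b k.+1) bk => // [bk|->] // _.
by apply: leq_trans (IH _); rewrite ?two_cluster_count_decr //; lia.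
Qed.

(** Monotonicity reduces this to [b = 2], where the ratio is $(2M-1)/(M-1)>2$. *)
Lemma two_cluster_count_0_2 M b : 1 < b <= M -> 2 * f M 0 b <= f M 0 1.
Proof.
move=> /andP[b1 bM]; apply: leq_trans (_ : 2 * f M 0 2 <= _).
  by rewrite leq_mul2l two_cluster_count_le //; lia.
rewrite /f !add0n !binn !mul1n.
have := mul_bin_diag (2 * M - 2).+1 (M - 2).
have -> : (2 * M - 2).+1 = 2 * M - 1 by lia.
have -> : (M - 2).+1 = M - 1 by lia.
have -> : (2 * M - 1).-1 = 2 * M - 2 by lia.
move: 'C(_, M - 2) 'C(_, M - 1) => x y; nia.
Qed.

(** For [a > 0], monotonicity reduces to [b = a + 1] and log-convexity to [a = 1], where the ratio
    to the maximum is $\frac{3M}{2(2M-1)}\le\frac9{10}<\frac{13}{14}$. The constants fit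
    [decay_le15], that is [N = 13] in [alpha_le]. *)
Lemma two_cluster_count_upper M a b : 2 < M -> a < b -> a + b <= M ->
  (a, b) != (0, 1) -> 14 * f M a b <= 13 * f M 0 1.
Proof.
move=> M3 ab abM; case: a ab abM => [|a] ab abM ne.
  have : 1 < b by case: b ab ne {abM} => [|[|b]].
  by move=> b1; have := @two_cluster_count_0_2 M b; lia.
have h : f M a.+1 b <= central 1 * central M.-2.
  apply: leq_trans (_ : f M a.+1 a.+2 <= _).
    by apply: two_cluster_count_le; lia.
  have aM : a.+1 < M by lia.
  rewrite (two_cluster_count_near aM).
  rewrite (_ : M.-2 = (a.+1 + (M - a.+1).-1).-1); last by lia.
  by apply: central_mul_le1; lia.
have M0 : 0 < M by lia.
rewrite (two_cluster_count_near M0) (_ : (M - 0).-1 = M.-2.+1); last by lia.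
rewrite (_ : central 0 = 1) // mul1n.
rewrite (_ : central 1 = 3) // in h.
have := centralS M.-2; move: h.
move: (f M a.+1 b) (central M.-2) (central M.-2.+1) => x y z; nia.
Qed.

Lemma bin_ge n k : 0 < k < n -> n <= 'C(n, k).
Proof.
elim: n k => // n IH [|k] // /andP[_].
rewrite ltnS leq_eqVlt => /orP[/eqP <-|kn]; first by rewrite binSn.
rewrite binS -addn1 leq_add ?IH // bin_gt0; lia.
Qed.

(** The reference count is [M + 1]. For [a = 0] the other counts are at least $\binom{M+2}2$; for
    [a > 0] each binomial coefficient is at least its upper index. *)
Lemma two_cluster_count_lower M a b : 2 < M -> a < b -> a + b <= M ->
  (a, b) != (0, M) -> (a, b) != (0, M.-1) -> 2 * f M 0 M.-1 <= f M a b.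
Proof.
move=> M3 ab abM ne1 ne2.
have -> : f M 0 M.-1 = M.+1.
  rewrite /f add0n binn mul1n.
  have -> : 2 * M - M.-1 = M.+1 by lia.
  have -> : M - M.-1 = 1 by lia.
  exact: bin1.
case: a ab abM ne1 ne2 => [|a] ab abM ne1 ne2.
  have bM : b <= M.-2 by move: ne1 ne2; rewrite !xpair_eqE /=; lia.
  apply: leq_trans (_ : f M 0 M.-2 <= _); last by apply: two_cluster_count_le; lia.
  rewrite /f add0n binn mul1n.
  have -> : 2 * M - M.-2 = M.+2 by lia.
  have -> : M - M.-2 = 2 by lia.
  have := mul_bin_diag M.+2 1; rewrite bin1 /=; move: 'C(_, _) => c; nia.
have h1 : a.+1 + b <= 'C(a.+1 + b, b) by apply: bin_ge; lia.
have h2 : 2 * M - (a.+1 + b) <= 'C(2 * M - (a.+1 + b), M - b) by apply: bin_ge; lia.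
apply: leq_trans (leq_mul h1 h2); nia.
Qed.

End Binomials.

(** * End letters of non-overlapping patterns *)

Section Endpoints.
Variables (M : nat) (s : 'S_M.+1).

Lemma letter_inj x y : x < M.+1 -> y < M.+1 -> letter s x = letter s y -> x = y.
Proof.
move=> xm ym; rewrite (letterE s (Ordinal xm)) (letterE s (Ordinal ym)).
by move=> [/val_inj/perm_inj/(congr1 val)].
Qed.

Lemma letter_le x : x < M.+1 -> 0 < letter s x <= M.+1.
Proof. by move=> xm; rewrite (letterE s (Ordinal xm)) /=; apply: ltn_ord. Qed.

Lemma letter_first : letter s 0 = (s ord0).+1.
Proof. exact: (letterE s ord0). Qed.

Lemma letter_last : letter s M = (s ord_max).+1.
Proof. exact: (letterE s ord_max). Qed.

(** Otherwise the last two letters would be ordered like the first two, and [M.-1] would lie in the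
    overlap set. *)
Lemma nonoverlap_ends : 1 < M -> non_overlapping (word s) ->
  (letter s M.-1 < letter s M) <> (letter s 0 < letter s 1).
Proof.
move=> M1 no eq_ends; have : M.-1 \in overlap_set (word s).
  apply/overlap_setP => [|x y xm ym]; first by lia.
  have x2 : x < 2 by lia.
  have y2 : y < 2 by lia.
  have e : M.-1 + 1 = M by lia.
  have neq1 : letter s M.-1 <> letter s M by move/letter_inj; lia.
  have neq2 : letter s 0 <> letter s 1 by move/letter_inj; lia.
  case: x y x2 y2 {xm ym} => [|[|x]] [|[|y]] // _ _; rewrite ?addn0 ?e ?ltnn //.
  by move: eq_ends neq1 neq2; lia.
by rewrite no inE size_word /=; lia.
Qed.

Lemma endpoints_neq : 0 < M -> s ord0 <> s ord_max.
Proof. by move=> M0 /perm_inj/(congr1 val) /=; lia. Qed.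

(** With opposite extremes at the ends, the first and last steps of the word go the same way. *)
Lemma nonoverlap_extremes : 1 < M -> non_overlapping (word s) ->
  ~ (s ord0 = 0 :> nat /\ s ord_max = M :> nat) /\
  ~ (s ord0 = M :> nat /\ s ord_max = 0 :> nat).
Proof.
move=> M1 /(nonoverlap_ends M1); rewrite letter_first letter_last => ne.
have l1 : letter s M.-1 <> letter s M by move/letter_inj; lia.
have l2 : letter s 0 <> letter s 1 by move/letter_inj; lia.
have l3 : 0 < letter s M.-1 <= M.+1 by apply: letter_le; lia.
have l4 : 0 < letter s 1 <= M.+1 by apply: letter_le; lia.
rewrite letter_last in l1; rewrite letter_first in l2.
by split=> -[a b]; apply: ne; rewrite a b in l1 l2 *; lia.
Qed.

(** In each of the four words with these ends, the first and last steps go the same way. The count 9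
    of this pair is too close to the maximum 10 for [alpha_le] to separate them. *)
Lemma nonoverlap_middle : M = 3 -> non_overlapping (word s) ->
  ~ (s ord0 = 1 :> nat /\ s ord_max = 2 :> nat) /\
  ~ (s ord0 = 2 :> nat /\ s ord_max = 1 :> nat).
Proof.
move=> M3 /(nonoverlap_ends ltac:(lia)).
have l1 : letter s 2 <> letter s 3 by move/letter_inj; lia.
have l2 : letter s 0 <> letter s 1 by move/letter_inj; lia.
have l3 : letter s 1 <> letter s 2 by move/letter_inj; lia.
have l4 : letter s 0 <> letter s 2 by move/letter_inj; lia.
have l5 : letter s 1 <> letter s 3 by move/letter_inj; lia.
have l6 : 0 < letter s 2 <= M.+1 by apply: letter_le; lia.
have l7 : 0 < letter s 1 <= M.+1 by apply: letter_le; lia.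
have e3 : letter s 3 = (s ord_max).+1 by rewrite -letter_last; congr letter.
have -> : M.-1 = 2 by lia.
rewrite letter_last letter_first; rewrite e3 ?letter_first in l1 l2 l4 l5 => ne.
by split=> -[a b]; apply: ne; rewrite a b in l1 l2 l4 l5 *; lia.
Qed.

(** A proper suffix of at least two letters ends in a descent, while the prefix of the same length
    increases. *)
Lemma non_overlapping_last_descent : 0 < M ->
  (forall x, x.+1 < M -> letter s x < letter s x.+1) ->
  letter s M < letter s M.-1 -> non_overlapping (word s).
Proof.
move=> M0 inc dec d; rewrite [RHS]inE size_word /=.
case: (boolP (0 < d <= M)) => [dM|dM]; last first.
  by rewrite inE size_word ltnS (negbTE dM) /=; lia.
case: (eqVneq d M) => [->|neq_dM].
  by apply/overlap_setP => [|x y xm ym]; [lia|rewrite (_ : x = y) ?ltnn //; lia].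
apply/negP => /(overlap_setP _ dM)/(_ (M - d).-1 (M - d) ltac:(lia) ltac:(lia)).
have -> : d + (M - d).-1 = M.-1 by lia.
have -> : d + (M - d) = M by lia.
have := inc (M - d).-1; rewrite (_ : (M - d).-1.+1 = M - d); last by lia.
by move=> ->; [rewrite ltnNge ltnW|lia].
Qed.

End Endpoints.

(** * Comparison with the extremal patterns *)

(** The orbit of a pair of end letters under reversal and complement. *)
Definition equiv_ends (M a b c d : nat) : Prop :=
  [\/ c = a /\ d = b, c = b /\ d = a, c = M - a /\ d = M - b
    | c = M - b /\ d = M - a].

Lemma canonical_ends M a b : a <= M -> b <= M -> a <> b ->
  exists c d, [/\ c < d, c + d <= M & equiv_ends M a b c d].
Proof.
move=> aM bM ab; case: (leqP (a + b) M) => abM; case: (ltnP a b) => lt_ab.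
- by exists a, b; split=> //; apply: Or41.
- by exists b, a; split; [lia|lia|apply: Or42].
- by exists (M - b), (M - a); split; [lia|lia|apply: Or44].
- by exists (M - a), (M - b); split; [lia|lia|apply: Or43].
Qed.

Lemma two_cluster_count_equiv M a b c d : a <= M -> b <= M ->
  equiv_ends M a b c d -> two_cluster_count M c d = two_cluster_count M a b.
Proof.
move=> aM bM [] [-> ->] //.
- exact: two_cluster_countC.
- exact: two_cluster_count_compl.
- by rewrite two_cluster_count_compl // two_cluster_countC.
Qed.

Lemma clusters_equiv M (s t : 'S_M.+1) k : 0 < M ->
  equiv_ends M (s ord0) (s ord_max) (t ord0) (t ord_max) ->
  clusters s (k * M).+1 k = clusters t (k * M).+1 k.
Proof.
move=> M0; have rev0 : rev_ord ord0 = ord_max :> 'I_M.+1.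
  by apply: val_inj; rewrite /= subn1.
have revM : rev_ord ord_max = ord0 :> 'I_M.+1 by apply: val_inj; rewrite /= subnn.
case=> -[e0 eM].
- by apply: clusters_endpoints => //; apply: val_inj.
- rewrite -clusters_rev; apply: clusters_endpoints => //; apply: val_inj;
    by rewrite permM rev_permE ?rev0 ?revM.
- rewrite -clusters_compl; apply: clusters_endpoints => //; apply: val_inj;
    by rewrite permM rev_permE /= subSS.
rewrite -clusters_rev -clusters_compl; apply: clusters_endpoints => //; apply: val_inj;
  by rewrite !permM !rev_permE ?rev0 ?revM /= subSS.
Qed.

Lemma alpha_equiv M (s t : 'S_M.+1) n : 0 < M ->
  non_overlapping (word s) -> non_overlapping (word t) ->
  equiv_ends M (s ord0) (s ord_max) (t ord0) (t ord_max) ->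
  alpha n (word s) = alpha n (word t).
Proof. by move=> M0 ns nt st; apply: alpha_eq => // k; apply: clusters_equiv. Qed.

Lemma alpha_two_last_ge M (s t : 'S_M.+1) n : 1 < M ->
  non_overlapping (word s) -> non_overlapping (word t) ->
  t ord0 = 0 :> nat -> t ord_max = 1 :> nat ->
  alpha n (word s) <= alpha n (word t).
Proof.
move=> M1 ns nt t0 tM; have M0 : 0 < M by lia.
have aM : s ord0 <= M by rewrite -ltnS.
have bM : s ord_max <= M by rewrite -ltnS.
have [x1 x2] := nonoverlap_extremes M1 ns.
have ab : s ord0 <> s ord_max :> nat by move/val_inj; apply: endpoints_neq.
have [c [d [cd cdM eq_cd]]] := canonical_ends aM bM ab.
have [/andP[/eqP c0 /eqP d1]|ne] := boolP ((c == 0) && (d == 1)).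
  by rewrite (alpha_equiv n M0 ns nt) // t0 tM; move: eq_cd; rewrite c0 d1.
(* For [M = 2] the canonical pairs are $(0,1)$, already treated, and $(0,2)$, which non-overlap
   forbids. *)
have nM2 : M <> 2 by case: eq_cd => -[]; lia.
have M3 : 2 < M by lia.
have clE : clusters s (2 * M).+1 2 = two_cluster_count M c d.
  by rewrite clusters2 // (two_cluster_count_equiv aM bM eq_cd).
have clt : clusters t (2 * M).+1 2 = two_cluster_count M 0 1.
  by rewrite clusters2 // t0 tM.
have [M4|M3'] := leqP 4 M.
  apply: (alpha_le M3 nt ns (decay_le15 rat M4)).
  by rewrite clE clt; apply: two_cluster_count_upper.
(* Here [decay M <= 1/4] gives [N = 2]. Excluding $(1,2)$ leaves [c = 0], where the factor 2 yields
   the required ratio 2/3. *)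
have ME : M = 3 by lia.
have [y1 y2] := nonoverlap_middle ME ns.
apply: (alpha_le M3 nt ns (decay_le4 rat M3)).
have c0 : c = 0 by case: eq_cd => -[]; lia.
have d1 : 1 < d <= M by lia.
by have := two_cluster_count_0_2 d1; rewrite clE clt c0; lia.
Qed.

Lemma alpha_swap_last_le M (s t : 'S_M.+1) n : 1 < M ->
  non_overlapping (word s) -> non_overlapping (word t) ->
  t ord0 = 0 :> nat -> t ord_max = M.-1 :> nat ->
  alpha n (word t) <= alpha n (word s).
Proof.
move=> M1 ns nt t0 tM; have M0 : 0 < M by lia.
have aM : s ord0 <= M by rewrite -ltnS.
have bM : s ord_max <= M by rewrite -ltnS.
have [x1 x2] := nonoverlap_extremes M1 ns.
have ab : s ord0 <> s ord_max :> nat by move/val_inj; apply: endpoints_neq.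
have [c [d [cd cdM eq_cd]]] := canonical_ends aM bM ab.
have [/andP[/eqP c0 /eqP d1]|ne] := boolP ((c == 0) && (d == M.-1)).
  by rewrite (alpha_equiv n M0 ns nt) // t0 tM; move: eq_cd; rewrite c0 d1.
have neM : ~ (c = 0 /\ d = M) by case: eq_cd => -[]; lia.
have M3 : 2 < M by lia.
have clE : clusters s (2 * M).+1 2 = two_cluster_count M c d.
  by rewrite clusters2 // (two_cluster_count_equiv aM bM eq_cd).
have clt : clusters t (2 * M).+1 2 = two_cluster_count M 0 M.-1.
  by rewrite clusters2 // t0 tM.
(* Again [N = 2]; the factor 2 of [two_cluster_count_lower] exceeds the required 3/2. *)
apply: (alpha_le M3 ns nt (decay_le4 rat M3)).
have ne0 : (c, d) != (0, M) by rewrite xpair_eqE; lia.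
by have := two_cluster_count_lower M3 cd cdM ne0 ne; rewrite clE clt; lia.
Qed.

(** * The two extremal patterns and the conclusion *)

Lemma nth_swap_last M x : 0 < M -> x <= M ->
  nth 0 (swap_last M.+1) x = if x < M.-1 then x.+1 else if x == M.-1 then M.+1 else M.
Proof.
move=> M0 xM; rewrite /swap_last nth_cat size_iota.
have -> : M.+1 - 2 = M.-1 by lia.
case: ltnP => [lt_x|le_x]; first by rewrite nth_iota.
case: eqP => [->|ne]; first by rewrite subnn.
by rewrite (_ : x - M.-1 = 1) //; lia.
Qed.

Lemma nth_two_last M x : 0 < M -> x <= M ->
  nth 0 (two_last M.+1) x = if x == 0 then 1 else if x == M then 2 else x.+2.
Proof.
move=> M0 xM; rewrite /two_last; case: x xM => [|x] xM //=.
rewrite nth_cat size_iota; have -> : M.+1 - 2 = M.-1 by lia.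
case: ltnP => [lt_x|le_x]; first by rewrite nth_iota // ifN ?add3n //; lia.
have -> : x = M.-1 by lia.
by rewrite subnn prednK // eqxx.
Qed.

Theorem theorem3p8 (m : nat) (hm : 3 <= m) (sigma : 'S_m)
    (hsigma : non_overlapping (word sigma)) :
  exists n0 : nat, forall n : nat, n0 <= n ->
    alpha n (swap_last m) <= alpha n (word sigma) /\
    alpha n (word sigma) <= alpha n (two_last m).
Proof.
have [u uE] := swap_last_word hm; have [v vE] := two_last_word hm.
case: m => [|M] // in hm sigma hsigma u uE v vE *.
have M0 : 0 < M by lia.
have lu x (xM : x <= M) : letter u x =
    if x < M.-1 then x.+1 else if x == M.-1 then M.+1 else M.
  by rewrite /letter uE nth_swap_last.
have lv x (xM : x <= M) : letter v x =
    if x == 0 then 1 else if x == M then 2 else x.+2.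
  by rewrite /letter vE nth_two_last.
have no_u : non_overlapping (word u).
  by apply: non_overlapping_last_descent => // [x xM|]; rewrite !lu; try lia;
    do 4?case: ifP; lia.
have no_v : non_overlapping (word v).
  by apply: non_overlapping_last_descent => // [x xM|]; rewrite !lv; try lia;
    do 4?case: ifP; lia.
(* The comparisons hold at every length, so the threshold is 0. *)
exists 0 => n _; rewrite -uE -vE; split.
  apply: alpha_swap_last_le => //; apply: succn_inj.
    by rewrite -letter_first lu //; case: ifP => //; lia.
  by rewrite -letter_last lu //; do 2?case: ifP; lia.
apply: alpha_two_last_ge => //; apply: succn_inj.
  by rewrite -letter_first lv.
by rewrite -letter_last lv // eqxx; case: ifP; lia.
Qed.
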